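(* Let $f\colon\mathfrak g\twoheadrightarrow\mathfrak h$ be a surjective map of pronilpotent curved Lie algebras, let $\mathfrak k$ be the kernel of $f$ (as a map of graded Lie algebras), let $\xi_0\in\mathrm{MC}(\mathfrak h)$ and let $\xi\in\mathfrak g$ be a degree one element with $f(\xi)=\xi_0$. Then the group $\exp(H^0(\mathfrak h^{\xi_0}))$ acts on $\mathscr{MC}(\mathfrak k^\xi)$, and the quotient $\mathscr{MC}(\mathfrak k^\xi)/\exp(H^0(\mathfrak h^{\xi_0}))$ is isomorphic to the fibre in $\mathscr{MC}(\mathfrak g)$ over (the class of) $\xi_0\in\mathscr{MC}(\mathfrak h)$.
   Context: The base field $k$ is normally $\mathbb Q$. A curved Lie algebra is a graded Lie algebra $\mathfrak g$ with a degree $2$ element $\Omega$ (curvature) and a degree $1$ derivation $d$ (predifferential) with $d^2\eta=[\eta,\Omega]$ for all $\eta$ and $d\Omega=0$; morphisms are graded Lie algebra maps preserving $d$ and $\Omega$. A dg Lie algebra is a curved Lie algebra with $\Omega=0$. Pronilpotent means an inverse limit of nilpotent curved Lie algebras. $\mathrm{MC}(\mathfrak g)$ is the set of degree $1$ elements $\xi$ with $\Omega+d\xi+\frac12[\xi,\xi]=0$. For a degree $1$ element $\xi\in\mathfrak g$, $\mathfrak g^\xi$ (twisting) is the underlying graded Lie algebra with curvature $\Omega+d\xi+\frac12[\xi,\xi]$ and predifferential $d+\mathrm{ad}_\xi$; it is a dg Lie algebra iff $\xi\in\mathrm{MC}(\mathfrak g)$. In particular $\mathfrak h^{\xi_0}$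 is a dg Lie algebra, $H^0(\mathfrak h^{\xi_0})$ is its degree $0$ cohomology. If $f(\xi)=\xi_0\in\mathrm{MC}(\mathfrak h)$, then $\mathfrak k=\ker f$ is a curved Lie subalgebra of $\mathfrak g^\xi$, denoted $\mathfrak k^\xi$ (curvature and predifferential restricted from $\mathfrak g^\xi$), and $\eta\mapsto\eta+\xi$ identifies $\mathrm{MC}(\mathfrak k^\xi)$ with the set of elements of $\mathrm{MC}(\mathfrak g)$ over $\xi_0$. For a pronilpotent Lie algebra $\mathfrak a$, $\exp(\mathfrak a)=\{e^x:x\in\mathfrak a\}$ with product given by the Baker–Campbell–Hausdorff formula. For a pronilpotent curved Lie algebra, $\exp(\mathfrak g^0)$ acts on $\mathrm{MC}(\mathfrak g)$ by the gauge action $$e^y\cdot\xi=\xi+\sum_{n\ge1}\frac1{n!}(\mathrm{ad}_y)^{n-1}(\mathrm{ad}_y\xi-dy).$$ $\mathscr{MC}(\mathfrak g)$ is the Maurer–Cartan moduli set: the quotient of $\mathrm{MC}(\mathfrak g)$ by gauge equivalence, equivalently by the equivalence relation generated by homotopy ($\xi,\eta$ are homotopic if there is $h\in\mathrm{MC}(\mathfrak g[z,dz])$, $\mathfrak g[z,dz]=\mathfrak g\otimes k[z,dz]$ with $|z|=0$, $|dz|=1$, $d(z)=dz$, restricting to $\xi$ at $z=0$ and $\eta$ at $z=1$).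
   Formalization: The curvature axiom for curved Lie algebras is taken as d²η = [Ω,η] instead of the printed d²η = [η,Ω]; with the printed sign the twist of h by the Maurer–Cartan element ξ₀ would not be a dg Lie algebra and H⁰ would be undefined. *)

(* Defs.v *)
From HB Require Import structures.
From mathcomp Require Import all_boot all_order all_algebra.
From mathcomp Require Import boolp classical_sets.
From Stdlib Require Import Relation_Operators.

Set Implicit Arguments.
Unset Strict Implicit.
Unset Printing Implicit Defensive.

Import GRing.Theory.
Local Open Scope ring_scope.

(* A graded object is a family indexed by [int].  Structure maps take a proof
  [e] of the degree equation as an argument, so that no transport between
  [g (i + j)] and [g (j + i)] is ever needed.

  Signs: [d] obeys the left Leibniz rule and [ad_x = [x, -]].  With these
  conventions, [d + ad_xi] and [Om + d xi + 1/2 [xi, xi]] form a curved Lie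
  algebra exactly when the curvature axiom reads [d (d x) = [Om, x]].  (The
  form [d (d x) = [x, Om]] belongs to right derivations; the two are exchanged
  by [d x |-> (-1)^|x| d x].) *)

Record curvedLie (k : fieldType) := CurvedLie {
  cl_car :> int -> lmodType k;
  cl_br : forall i j m : int, i + j = m -> cl_car i -> cl_car j -> cl_car m;
  cl_d : forall i j : int, i + 1 = j -> cl_car i -> cl_car j;
  cl_Om : cl_car 2%:R;
  cl_br_linl : forall i j m (e : i + j = m) y, linear (fun x => cl_br e x y);
  cl_br_linr : forall i j m (e : i + j = m) x, linear (cl_br e x);
  cl_anti : forall i j m (e : i + j = m) (e' : j + i = m) x y,
    cl_br e x y = - ((-1) ^ (i * j) *: cl_br e' y x);
  cl_jacobi : forall i j l a b c m
      (ij : i + j = a) (jl : j + l = b) (il : i + l = c)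
      (ib : i + b = m) (al : a + l = m) (jc : j + c = m) x y z,
    cl_br ib x (cl_br jl y z) =
      cl_br al (cl_br ij x y) z + (-1) ^ (i * j) *: cl_br jc y (cl_br il x z);
  cl_d_lin : forall i j (e : i + 1 = j), linear (cl_d e);
  cl_leibniz : forall i j m i' j' m' (e : i + j = m) (em : m + 1 = m')
      (ei : i + 1 = i') (ej : j + 1 = j') (e1 : i' + j = m') (e2 : i + j' = m')
      x y,
    cl_d em (cl_br e x y) =
      cl_br e1 (cl_d ei x) y + (-1) ^ i *: cl_br e2 x (cl_d ej y);
  cl_dd : forall i j m (e1 : i + 1 = j) (e2 : j + 1 = m) (e3 : 2%:R + i = m) x,
    cl_d e2 (cl_d e1 x) = cl_br e3 cl_Om x;
  cl_dOm : forall m (e : 2%:R + 1 = m), cl_d e cl_Om = 0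
}.

HB.instance Definition _ (k : fieldType) (g : curvedLie k) (i j : int)
    (e : i + 1 = j) :=
  GRing.isLinear.Build k (g i) (g j) *:%R (cl_d e) (cl_d_lin e).

HB.instance Definition _ (k : fieldType) (g : curvedLie k) (i j m : int)
    (e : i + j = m) (x : g i) :=
  GRing.isLinear.Build k (g j) (g m) *:%R (cl_br e x) (cl_br_linr e x).

Record curvedHom (k : fieldType) (g h : curvedLie k) := CurvedHom {
  ch_fun :> forall i : int, g i -> h i;
  ch_lin : forall i, linear (@ch_fun i);
  ch_br : forall i j m (e : i + j = m) x y,
    ch_fun (cl_br e x y) = cl_br e (ch_fun x) (ch_fun y);
  ch_d : forall i j (e : i + 1 = j) x, ch_fun (cl_d e x) = cl_d e (ch_fun x);
  ch_Om : ch_fun (cl_Om g) = cl_Om h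
}.

Arguments ch_fun {k g h} f i x : rename.

HB.instance Definition _ (k : fieldType) (g h : curvedLie k)
    (f : curvedHom g h) (i : int) :=
  GRing.isLinear.Build k (g i) (h i) *:%R (ch_fun f i) (@ch_lin k g h f i).

Section BasicLemmas.
Context (k : fieldType) (g : curvedLie k).

Lemma brDl (i j m : int) (e : i + j = m) (x x' : g i) (y : g j) :
  cl_br e (x + x') y = cl_br e x y + cl_br e x' y.
Proof. by have := cl_br_linl e y 1 x x'; rewrite /= !scale1r. Qed.

Lemma br0l (i j m : int) (e : i + j = m) (y : g j) : cl_br e (0 : g i) y = 0.
Proof. by apply: (addIr (cl_br e 0 y)); rewrite -brDl !add0r. Qed.

Lemma brZl (i j m : int) (e : i + j = m) a (x : g i) (y : g j) :
  cl_br e (a *: x) y = a *: cl_br e x y.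
Proof.
by have := cl_br_linl e y a x 0; rewrite /= br0l !addr0.
Qed.

Lemma natr_neq0 (k0 : has_pchar0 k) n : (n.+1%:R : k) != 0.
Proof. by rewrite ((pcharf0P k).1 k0). Qed.

End BasicLemmas.

(* [lcs n i x]: [x] is in the degree [i] part of the [n]-th term of the lower
   central series [g, [g, g], [g, [g, g]], ...]. *)
Inductive lcs (k : fieldType) (g : curvedLie k) :
    nat -> forall i : int, g i -> Prop :=
| lcs_top i (x : g i) : lcs 0 x
| lcs_br n i j m (e : i + j = m) (x : g i) (y : g j) :
    lcs n y -> lcs n.+1 (cl_br e x y)
| lcs_lin n i a (x y : g i) : lcs n x -> lcs n y -> lcs n (a *: x + y).

Definition nilpotent (k : fieldType) (g : curvedLie k) : Prop :=
  exists n, forall i (x : g i), lcs n x -> x = 0.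

(* A family of maps to nilpotent curved Lie algebras.  It defines a topology
   on [g]: a sequence converges when its image in each member of the family is
   eventually constant. *)
Record nilCone (k : fieldType) (g : curvedLie k) := NilCone {
  nc_idx : Type;
  nc_obj : nc_idx -> curvedLie k;
  nc_nil : forall a, nilpotent (nc_obj a);
  nc_proj : forall a, curvedHom g (nc_obj a)
}.

Arguments nc_obj {k g} C a : rename.
Arguments nc_nil {k g} C a : rename.
Arguments nc_proj {k g} C a : rename.

(* A presentation of [g] as the inverse limit, over a directed preorder, of
   nilpotent curved Lie algebras. *)
Record pronilpotent (k : fieldType) (g : curvedLie k) := Pronilpotent {
  pn_cone :> nilCone g;
  pn_le : nc_idx pn_cone -> nc_idx pn_cone -> Prop;
  pn_inh : inhabited (nc_idx pn_cone);
  pn_refl : forall a, pn_le a a;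
  pn_trans : forall b a c, pn_le a b -> pn_le b c -> pn_le a c;
  pn_dir : forall a b, exists c, pn_le a c /\ pn_le b c;
  pn_map : forall a b, pn_le a b ->
    curvedHom (nc_obj pn_cone b) (nc_obj pn_cone a);
  pn_map_id : forall a (e : pn_le a a) i (x : nc_obj pn_cone a i),
    pn_map e i x = x;
  pn_map_comp : forall a b c (ab : pn_le a b) (bc : pn_le b c) (ac : pn_le a c)
      i (x : nc_obj pn_cone c i),
    pn_map ab i (pn_map bc i x) = pn_map ac i x;
  pn_proj : forall a b (ab : pn_le a b) i (x : g i),
    pn_map ab i (nc_proj pn_cone b i x) = nc_proj pn_cone a i x;
  pn_lim : forall (i : int) (u : forall a, nc_obj pn_cone a i),
    (forall a b (ab : pn_le a b), pn_map ab i (u b) = u a) ->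
    exists! x : g i, forall a, nc_proj pn_cone a i x = u a
}.

Section Limits.
Context (k : fieldType) (g : curvedLie k) (C : nilCone g).

Definition sums_to (i : int) (u : nat -> g i) (s : g i) : Prop :=
  forall a, exists N : nat, forall n : nat, (N <= n)%N ->
    nc_proj C a i (\sum_(0 <= r < n) u r) = nc_proj C a i s.

(* The sum of a convergent series (and [0] for a divergent one). *)
Definition series_sum (i : int) (u : nat -> g i) : g i :=
  xget 0 (fun s => sums_to u s).

Definition ad0 (i : int) (y : g 0) : g i -> g i := cl_br (add0r i) y.

(* [(y, xi) |-> e^y . xi]; the term of index [r] is the one with
   [1 / (r + 1)!]. *)
Definition gauge (y : g 0) (xi : g 1) : g 1 :=
  xi + series_sum (fun r =>
    (r.+1`!%:R : k)^-1 *: iter r (ad0 y) (ad0 y xi - cl_d (add0r 1) y)).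

(* [[w_0, [w_1, ... [w_(n-1), w_n]]]] *)
Fixpoint nested_br (w : seq (g 0)) : g 0 :=
  match w with
  | [::] => 0
  | x :: w' => if w' is [::] then x else ad0 x (nested_br w')
  end.

(* The component of degree [n] of the Baker-Campbell-Hausdorff series, in
   Dynkin's form: the sum over [m >= 1] and over [(r_1, s_1), ..., (r_m, s_m)]
   with [r_i + s_i > 0] and [sum_i (r_i + s_i) = n] of
   (-1)^(m-1) / m * [x^r_1 y^s_1 ... x^r_m y^s_m] / (n * prod_i r_i! s_i!).
   The constraints force [m <= n] and [r_i, s_i <= n]. *)
Definition bch_term (x y : g 0) (n : nat) : g 0 :=
  \sum_(m < n) \sum_(p : {ffun 'I_m.+1 -> 'I_n.+1 * 'I_n.+1} |
         [forall i, 0 < (p i).1 + (p i).2]%N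
         && (\sum_i ((p i).1 + (p i).2) == n)%N)
    ((-1) ^+ m / (m.+1%:R * n%:R * \prod_i ((p i).1`! * (p i).2`!)%:R) : k) *:
      nested_br (flatten [seq nseq (p i).1 x ++ nseq (p i).2 y
                         | i <- enum 'I_m.+1]).

Definition bch (x y : g 0) : g 0 := series_sum (bch_term x y).

End Limits.

(* The quotient of [T] by the equivalence relation generated by [R]. *)
Section Quotient.
Context (T : choiceType) (R : T -> T -> Prop).

Definition gen_rel : rel T := fun x y => `[< clos_refl_sym_trans T R x y >].

Lemma gen_refl : reflexive gen_rel.
Proof. by move=> x; apply/asboolP; apply: rst_refl. Qed.

Lemma gen_sym : symmetric gen_rel.
Proof.
by move=> x y; apply/asboolP/asboolP => h; apply: rst_sym.
Qed.

Lemma gen_trans : transitive gen_rel.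
Proof.
by move=> y x z /asboolP xy /asboolP yz; apply/asboolP; apply: rst_trans xy yz.
Qed.

Canonical gen_equiv := EquivRel gen_rel gen_refl gen_sym gen_trans.

Definition quot : Type := {eq_quot gen_equiv}%qT.
HB.instance Definition _ := Choice.on quot.

Definition cls (x : T) : quot := (\pi_({eq_quot gen_equiv}) x)%qT.
Definition rep (c : quot) : T := repr (c : {eq_quot gen_equiv}%qT).

End Quotient.

Definition curv (k : fieldType) (g : curvedLie k) (xi : g 1) : g 2%:R :=
  cl_Om g + cl_d (erefl : 1 + 1 = 2%:R :> int) xi
  + (2%:R : k)^-1 *: cl_br (erefl : 1 + 1 = 2%:R :> int) xi xi.

Definition MC (k : fieldType) (g : curvedLie k) : Type :=
  {xi : g 1 | curv xi == 0}.
HB.instance Definition _ (k : fieldType) (g : curvedLie k) :=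
  Choice.on (MC g).

Definition mc_val (k : fieldType) (g : curvedLie k) (xi : MC g) : g 1 := val xi.

Lemma mc_valP (k : fieldType) (g : curvedLie k) (xi : MC g) :
  curv (mc_val xi) = 0.
Proof. exact: (eqP (valP xi)). Qed.

Section Twist.
Context (k : fieldType) (k0 : has_pchar0 k) (g : curvedLie k) (xi : g 1).

Definition tw_d (i j : int) (e : i + 1 = j) (x : g i) : g j :=
  cl_d e x + cl_br (etrans (addrC 1 i) e) xi x.

Lemma tw_d_lin (i j : int) (e : i + 1 = j) : linear (tw_d e).
Proof.
move=> a x y; rewrite /tw_d !linearP scalerDr !addrA; congr (_ + _).
by rewrite /= addrAC.
Qed.

Lemma tw_leibniz (i j m i' j' m' : int) (e : i + j = m) (em : m + 1 = m')
    (ei : i + 1 = i') (ej : j + 1 = j') (e1 : i' + j = m') (e2 : i + j' = m')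
    (x : g i) (y : g j) :
  tw_d em (cl_br e x y) =
    cl_br e1 (tw_d ei x) y + (-1) ^ i *: cl_br e2 x (tw_d ej y).
Proof.
rewrite /tw_d (cl_leibniz e em ei ej e1 e2) brDl linearD scalerDr.
rewrite (cl_jacobi (etrans (addrC 1 i) ei) e (etrans (addrC 1 j) ej) _ e1 e2).
by rewrite mul1r addrACA.
Qed.

Lemma half_double (V : lmodType k) (v w : V) :
  v = w - v -> v = (2%:R : k)^-1 *: w.
Proof.
move=> h; have -> : w = 2%:R *: v.
  by rewrite scaler_nat mulr2n {1}h subrK.
by rewrite scalerA mulVf ?scale1r // natr_neq0.
Qed.

Lemma br_xi_xi (i j m : int) (e1 : 1 + i = j) (e2 : 1 + j = m) (e : 2%:R + i = m)
    (x : g i) :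
  cl_br e2 xi (cl_br e1 xi x) =
    (2%:R : k)^-1 *: cl_br e (cl_br (erefl : 1 + 1 = 2%:R :> int) xi xi) x.
Proof.
apply: half_double.
rewrite {1}(cl_jacobi erefl e1 e1 e2 e e2).
by rewrite mul1r expr1z scaleN1r.
Qed.

Lemma sign2 : (-1) ^ (2%:R : int) = 1 :> k.
Proof. by rewrite -[LHS]/((-1) ^+ 2) sqrrN expr1n. Qed.

Lemma br_xi_xi_xi (m : int) (e : 1 + 2%:R = m) :
  cl_br e xi (cl_br (erefl : 1 + 1 = 2%:R :> int) xi xi) = 0.
Proof.
have e' : 2%:R + 1 = m by rewrite addrC.
set v := LHS.
have h : v = - v - v.
  rewrite /v {1}(cl_jacobi erefl erefl erefl e e' e) (cl_anti e' e).
  by rewrite mulr1 sign2 scale1r mulr1 expr1z scaleN1r.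
have : (3%:R : k) *: v = 0.
  by rewrite scaler_nat !mulrS mulr0n addr0 {1}h addrACA addNr addr0.
by move/eqP; rewrite scaler_eq0 (negbTE (natr_neq0 _ _)) //= => /eqP.
Qed.

Lemma tw_dd (i j m : int) (e1 : i + 1 = j) (e2 : j + 1 = m) (e3 : 2%:R + i = m)
    (x : g i) :
  tw_d e2 (tw_d e1 x) = cl_br e3 (curv xi) x.
Proof.
rewrite /tw_d /curv !linearD !brDl brZl /= (cl_dd e1 e2 e3).
rewrite (cl_leibniz _ e2 (erefl : 1 + 1 = 2%:R :> int) e1 e3
           (etrans (addrC 1 j) e2)).
rewrite expr1z scaleN1r -(br_xi_xi (etrans (addrC 1 i) e1) (etrans (addrC 1 j) e2) e3).
by rewrite /= !addrA subrK.
Qed.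

Lemma tw_dcurv (m : int) (e : 2%:R + 1 = m) : tw_d e (curv xi) = 0.
Proof.
rewrite /tw_d /curv !linearD !linearZ /= cl_dOm add0r.
rewrite br_xi_xi_xi scaler0 addr0 (cl_dd _ e e).
rewrite (cl_leibniz _ e erefl erefl e (etrans (addrC 1 2%:R) e)).
rewrite expr1z scaleN1r (cl_anti (etrans (addrC 1 2%:R) e) e xi (cl_Om g)).
rewrite (cl_anti (etrans (addrC 1 2%:R) e) e xi (cl_d erefl xi)).
rewrite !mul1r sign2 !scale1r opprK -mulr2n -scaler_nat scalerA.
by rewrite mulVf ?natr_neq0 // scale1r addrACA subrr add0r subrr.
Qed.

(* [g^xi] *)
Definition twist : curvedLie k :=
  CurvedLie (@cl_br_linl k g) (@cl_br_linr k g) (@cl_anti k g) (@cl_jacobi k g)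
    tw_d_lin tw_leibniz tw_dd tw_dcurv.

Lemma lcs_twist n i (x : g i) : @lcs k twist n i x -> lcs n x.
Proof.
elim=> {n i x} [i x|n i j m e x y _ IH|n i a x y _ IHx _ IHy].
- exact: lcs_top.
- exact: lcs_br IH.
- exact: lcs_lin IHx IHy.
Qed.

Lemma twist_nilpotent : nilpotent g -> nilpotent twist.
Proof. by move=> [n h]; exists n => i x /lcs_twist; apply: h. Qed.

End Twist.

Section Homs.
Context (k : fieldType).

Definition hom_comp (g h l : curvedLie k) (f : curvedHom h l)
  (f' : curvedHom g h) : curvedHom g l.
Proof.
apply: (@CurvedHom k g l (fun i x => f i (f' i x))).
- by move=> i a x y; rewrite !linearP.
- by move=> i j m e x y; rewrite !ch_br.
- by move=> i j e x; rewrite !ch_d.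
- by rewrite !ch_Om.
Defined.

Lemma hom_curv (g h : curvedLie k) (f : curvedHom g h) (xi : g 1) :
  f 2%:R (curv xi) = curv (f 1 xi).
Proof. by rewrite /curv !linearD linearZ /= ch_Om ch_d ch_br. Qed.

Definition twist_hom (k0 : has_pchar0 k) (g h : curvedLie k)
  (f : curvedHom g h) (xi : g 1) (zeta : h 1) (e : f 1 xi = zeta) :
  curvedHom (twist k0 xi) (twist k0 zeta).
Proof.
apply: (@CurvedHom k (twist k0 xi) (twist k0 zeta) (ch_fun f)).
- by move=> i; exact: (@ch_lin k g h f i).
- by move=> i j m e'; exact: (@ch_br k g h f i j m e').
- by move=> i j e' x; rewrite /= /tw_d linearD /= ch_d ch_br e.
- by rewrite /= hom_curv e.
Defined.

Definition MC_hom (g h : curvedLie k) (f : curvedHom g h) (xi : MC g) : MC h.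
Proof.
exists (f 1 (mc_val xi)).
by rewrite -hom_curv mc_valP linear0.
Defined.

End Homs.

(* Every pronilpotent presentation of [g] is one of [g^xi]. *)
Section TwistPronilpotent.
Context (k : fieldType) (k0 : has_pchar0 k) (g : curvedLie k) (xi : g 1).

Definition twist_cone (C : nilCone g) : nilCone (twist k0 xi) :=
  NilCone (fun a => twist_nilpotent k0 (nc_proj C a 1 xi) (nc_nil C a))
    (fun a => twist_hom k0 (erefl (nc_proj C a 1 xi))).

Definition twist_pronilpotent (P : pronilpotent g) :
  pronilpotent (twist k0 xi).
Proof.
apply: (@Pronilpotent k (twist k0 xi) (twist_cone P) (@pn_le k g P)
  (pn_inh P) (@pn_refl k g P) (@pn_trans k g P) (@pn_dir k g P)
  (fun a b ab => twist_hom k0 (@pn_proj k g P a b ab 1 xi))).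
- exact: pn_map_id.
- exact: pn_map_comp.
- exact: pn_proj.
- exact: pn_lim.
Defined.

End TwistPronilpotent.

Section Kernel.
Context (k : fieldType) (g h : curvedLie k) (f : curvedHom g h).

Definition ker_pred (i : int) : {pred g i} := fun x => f i x == 0.

Lemma ker_pred_submod i : submod_closed (@ker_pred i).
Proof.
split=> [|a x y]; rewrite !unfold_in ?linear0 // => /eqP hx /eqP hy.
by rewrite linearP /= hx hy scaler0 addr0.
Qed.

HB.instance Definition _ i :=
  GRing.isSubmodClosed.Build k (g i) (@ker_pred i) (@ker_pred_submod i).

Record ker_sort (i : int) :=
  KerSort { ker_val : g i; ker_valP : ker_val \in @ker_pred i }.

HB.instance Definition _ i := [isSub for @ker_val i].
HB.instance Definition _ i := [Choice of ker_sort i by <:].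
HB.instance Definition _ i := [SubChoice_isSubLmodule of ker_sort i by <:].

(* When the target has curvature [0], the kernel contains the curvature of
   [g] and is a curved Lie subalgebra. *)
Context (h0 : cl_Om h = 0).

Lemma ker_brP i j m (e : i + j = m) (x : ker_sort i) (y : ker_sort j) :
  cl_br e (ker_val x) (ker_val y) \in @ker_pred m.
Proof.
have /eqP hy : f j (ker_val y) == 0 := ker_valP y.
by rewrite unfold_in ch_br hy linear0.
Qed.

Lemma ker_dP i j (e : i + 1 = j) (x : ker_sort i) :
  cl_d e (ker_val x) \in @ker_pred j.
Proof.
have /eqP hx : f i (ker_val x) == 0 := ker_valP x.
by rewrite unfold_in ch_d hx linear0.
Qed.

Lemma ker_OmP : cl_Om g \in @ker_pred 2%:R.
Proof. by rewrite unfold_in ch_Om h0. Qed.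

Definition kerLie : curvedLie k.
Proof.
apply: (@CurvedLie k (fun i => ker_sort i)
  (fun i j m e x y => KerSort (ker_brP e x y))
  (fun i j e x => KerSort (ker_dP e x)) (KerSort ker_OmP)).
- by move=> i j m e y a x x'; apply: val_inj; exact: cl_br_linl.
- by move=> i j m e x a y y'; apply: val_inj; exact: cl_br_linr.
- by move=> i j m e e' x y; apply: val_inj; exact: cl_anti.
- move=> i j l a b c m ij jl il ib al jc x y z; apply: val_inj.
  exact: cl_jacobi.
- by move=> i j e a x y; apply: val_inj; exact: cl_d_lin.
- move=> i j m i' j' m' e em ei ej e1 e2 x y; apply: val_inj.
  exact: cl_leibniz.
- by move=> i j m e1 e2 e3 x; apply: val_inj; exact: cl_dd.
- by move=> m e; apply: val_inj; exact: cl_dOm.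
Defined.

Definition ker_incl : curvedHom kerLie g.
Proof.
exact: (@CurvedHom k kerLie g (@ker_val) (fun i a x y => erefl)
  (fun i j m e x y => erefl) (fun i j e x => erefl) erefl).
Defined.

(* The topology on the kernel is the one induced by [g].  The kernel of a
   continuous map is itself the inverse limit of its images in the nilpotent
   curved Lie algebras of this family, and that limit topology is the induced
   one. *)
Definition ker_cone (C : nilCone g) : nilCone kerLie :=
  NilCone (nc_nil C) (fun a => hom_comp (nc_proj C a) ker_incl).

End Kernel.

(* Since the gauge action is an action of the group [exp (g^0)], the relation
   [gauge_step] is already an equivalence; [quot] takes the equivalence it
   generates so that this fact is not needed to form the quotient. *)
Definition gauge_step (k : fieldType) (g : curvedLie k) (C : nilCone g)
    (xi xi' : MC g) : Prop :=
  exists y : g 0, mc_val xi' = gauge C y (mc_val xi).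

Definition MCmod (k : fieldType) (g : curvedLie k) (C : nilCone g) : Type :=
  quot (gauge_step C).
HB.instance Definition _ (k : fieldType) (g : curvedLie k) (C : nilCone g) :=
  Choice.on (MCmod C).

Definition MCcls (k : fieldType) (g : curvedLie k) (C : nilCone g)
  (xi : MC g) : MCmod C := cls (gauge_step C) xi.

Definition MCmod_hom (k : fieldType) (g h : curvedLie k) (C : nilCone g)
    (D : nilCone h) (f : curvedHom g h) (c : MCmod C) : MCmod D :=
  MCcls D (MC_hom f (rep c)).

Section ExpH0.
Context (k : fieldType) (a : curvedLie k) (P : pronilpotent a).

Definition Z0 : Type := {x : a 0 | cl_d (add0r 1) x == 0}.
HB.instance Definition _ := Choice.on Z0.

Definition z0_val (x : Z0) : a 0 := val x.

Lemma z0_valP (x : Z0) : cl_d (add0r 1) (z0_val x) = 0.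
Proof. exact: (eqP (valP x)). Qed.

Definition cohomologous (x y : Z0) : Prop :=
  exists w : a (- 1), z0_val x - z0_val y = cl_d (addNr 1) w.

Definition H0 : Type := quot cohomologous.
HB.instance Definition _ := Choice.on H0.

Definition H0cls (x : Z0) : H0 := cls cohomologous x.

Lemma proj_inj i (x y : a i) :
  (forall l, nc_proj P l i x = nc_proj P l i y) -> x = y.
Proof.
move=> hxy; have [|z [_ uz]] := @pn_lim k a P i (fun l => nc_proj P l i y).
  by move=> l l' e; apply: pn_proj.
by rewrite -(uz x hxy); apply: uz.
Qed.

Lemma nested_br_cocycle (w : seq (a 0)) :
  {in w, forall x, cl_d (add0r 1) x = 0} ->
  cl_d (add0r 1) (nested_br w) = 0.
Proof.
elim: w => [|x [|y w] IH] hw; first by rewrite linear0.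
  by apply: hw; rewrite inE.
rewrite [nested_br _]/(ad0 x (nested_br (y :: w))) /ad0.
rewrite (cl_leibniz _ _ (add0r 1) (add0r 1) (addr0 1) (add0r 1)).
rewrite (hw x) ?mem_head // br0l IH ?linear0 ?scaler0 ?addr0 // => z hz.
by apply: hw; rewrite inE hz orbT.
Qed.

Lemma bch_term_cocycle (x y : a 0) n :
  cl_d (add0r 1) x = 0 -> cl_d (add0r 1) y = 0 ->
  cl_d (add0r 1) (bch_term x y n) = 0.
Proof.
move=> hx hy; rewrite /bch_term linear_sum big1 // => m _.
rewrite linear_sum big1 // => p _; rewrite linearZ /=.
rewrite nested_br_cocycle ?scaler0 // => z /flattenP [s /mapP [i _ ->]].
by rewrite mem_cat !mem_nseq => /orP [] /andP [_ /eqP ->].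
Qed.

Lemma bch_cocycle (x y : a 0) :
  cl_d (add0r 1) x = 0 -> cl_d (add0r 1) y = 0 ->
  cl_d (add0r 1) (bch P x y) = 0.
Proof.
move=> hx hy; rewrite /bch /series_sum.
case: xgetP => [s _ hs|_]; last by rewrite linear0.
apply: proj_inj => l; have [N hN] := hs l.
rewrite ch_d -(hN N (leqnn N)) -ch_d linear_sum big1 ?linear0 // => r _.
exact: bch_term_cocycle.
Qed.

Lemma Z0_bchP (x y : Z0) : cl_d (add0r 1) (bch P (z0_val x) (z0_val y)) == 0.
Proof. by rewrite bch_cocycle ?z0_valP. Qed.

Lemma Z0_zeroP : cl_d (add0r 1) (0 : a 0) == 0.
Proof. by rewrite linear0. Qed.

Lemma Z0_oppP (x : Z0) : cl_d (add0r 1) (- z0_val x) == 0.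
Proof. by rewrite linearN /= z0_valP oppr0. Qed.

(* [exp (H^0 (a))] has underlying set [H0 = H^0 (a)], [c] standing for [e^c].
   The product is computed on cocycles; it does not depend on representatives,
   since each term of BCH changes by the coboundary of a Lie series (no
   closedness of the coboundaries is needed). *)
Definition exp_mul (c c' : H0) : H0 :=
  H0cls (exist _ (bch P (z0_val (rep c)) (z0_val (rep c')))
               (Z0_bchP (rep c) (rep c'))).

Definition exp_one : H0 := H0cls (exist _ 0 Z0_zeroP).

Definition exp_inv (c : H0) : H0 :=
  H0cls (exist _ (- z0_val (rep c)) (Z0_oppP (rep c))).

End ExpH0.

Section Fibre.
Context (k : fieldType) (k0 : has_pchar0 k) (g h : curvedLie k).
Context (f : curvedHom g h) (xi0 : MC h) (xi : g 1) (e : f 1 xi = mc_val xi0).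

(* [k^xi], the kernel of [f : g^xi -> h^xi0]. *)
Definition fibre_lie : curvedLie k :=
  kerLie (twist_hom k0 e) (mc_valP xi0).

Definition fibre_cone (C : nilCone g) : nilCone fibre_lie :=
  ker_cone (twist_hom k0 e) (mc_valP xi0) (twist_cone k0 xi C).

Definition shift (eta : fibre_lie 1) : g 1 := (ker_val eta : g 1) + xi.

Lemma curv_shift (eta : fibre_lie 1) :
  curv (shift eta) = ker_val (curv eta).
Proof.
have br11C (x y : g 1) : cl_br (erefl : 1 + 1 = 2%:R :> int) x y =
    cl_br (erefl : 1 + 1 = 2%:R :> int) y x.
  by rewrite {1}(cl_anti erefl erefl) mulr1 expr1z scaleN1r opprK.
rewrite /shift; pose u : g 1 := ker_val eta; rewrite -[ker_val eta]/u.
have -> : ker_val (curv eta) = @curv k (twist k0 xi) u.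
  exact: (hom_curv (ker_incl (twist_hom k0 e) (mc_valP xi0))).
have -> : @curv k (twist k0 xi) u = curv xi
    + (cl_d (erefl : 1 + 1 = 2%:R :> int) u
       + cl_br (etrans (addrC 1 1) erefl : 1 + 1 = 2%:R :> int) xi u)
    + (2%:R : k)^-1 *: cl_br (erefl : 1 + 1 = 2%:R :> int) u u.
  exact: erefl.
have -> : etrans (addrC 1 1) erefl = erefl :> (1 + 1 = 2%:R :> int).
  exact: eq_irrelevance.
rewrite /curv !linearD /= !brDl !scalerDr (br11C u xi).
set v := cl_br _ xi u.
have hv : (2%:R : k)^-1 *: v + (2%:R : k)^-1 *: v = v.
  rewrite -mulr2n -scaler_nat scalerA mulfV ?scale1r //.
  exact: natr_neq0.
rewrite -[X in _ = _ + (_ + X) + _]hv !addrA.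
by rewrite [LHS](ACl (1*3*7*2*5*6*4)%AC).
Qed.

Definition MC_shift (eta : MC fibre_lie) : MC g.
Proof.
exists (shift (mc_val eta)).
by rewrite curv_shift mc_valP.
Defined.

End Fibre.

Definition MCfibre (k : fieldType) (g h : curvedLie k) (C : nilCone g)
    (D : nilCone h) (f : curvedHom g h) (xi0 : MC h) : Type :=
  {c : MCmod C | MCmod_hom D f c == MCcls D xi0}.

Definition act_orbits (A : Type) (T : choiceType) (act : A -> T -> T) : Type :=
  quot (fun c c' : T => exists a, act a c = c').

Definition act_orbit (A : Type) (T : choiceType) (act : A -> T -> T) (c : T) :
  act_orbits act := cls (fun c c' : T => exists a, act a c = c') c.

(* Main.v *)
(* The gauge action of [y] on [g 1] is the exponential of a linear action on
   [g 1 + k delta], so it is an action of the group [(g 0, bch)] as soon as the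
   Baker-Campbell-Hausdorff series, in Dynkin's form, satisfies
   [exp (bch x y) = exp x exp y] in nilpotent representations.  That identity is
   obtained by adjoining the Euler derivation [E = t d/dt] to an algebra of
   polynomials: if [exp D = exp (t X) exp (t Y)], then
   [ad D = log (exp (ad (t X)) exp (ad (t Y)))], and evaluating both sides at
   [- E] gives [E D] as a sum of nested brackets.  Since [E] is injective on
   polynomials without constant term, the same device makes the adjoint action
   faithful, which gives associativity of [bch].

   A surjection [f] need not be continuous, but the tails of the BCH and gauge
   series lie in the algebraic lower central series, so [f] commutes with them.
   A class [e^x] of cocycles then acts on solutions over [xi0] through any lift
   of [x] to [g 0]: lifts differ by gauge transformations in the kernel, and a
   coboundary lifts to an element [d^zeta V], which fixes [zeta].  Finally, a
   gauge transformation between two solutions over [xi0] lies over the stabilizer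
   of [xi0], which consists of the cocycles of the twisted differential. *)

From HB Require Import structures.
Require Import Defs.
From mathcomp Require Import all_boot all_order all_algebra.
From mathcomp Require Import boolp classical_sets.
From mathcomp Require Import ring zify.
From Stdlib Require Import Relation_Operators.
Set Implicit Arguments.
Unset Strict Implicit.
Unset Printing Implicit Defensive.
Import GRing.Theory.
Local Open Scope ring_scope.

(** * The exponential and logarithm series *)

Section ExpLogPoly.
Context (k : fieldType) (k0 : has_pchar0 k).

Definition expp N : {poly k} := \poly_(i < N) (i`!%:R)^-1.
(** Truncation of log (1 + X), not of log X; [hlog] below follows the same convention. *)
Definition logp N : {poly k} := 'X * \poly_(i < N) ((-1) ^+ i / i.+1%:R).

Lemma expp0 N : (expp N.+1).[0] = 1.
Proof. by rewrite horner_coef0 coef_poly /= invr1. Qed.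

Lemma logp0 N : (logp N).[0] = 0.
Proof. by rewrite hornerM hornerX mul0r. Qed.

Lemma deriv_expp N :
  (expp N.+1)^`() = expp N.+1 - (N`!%:R)^-1 *: 'X^N.
Proof.
apply/polyP => i; rewrite coef_deriv !coefB coefZ coefXn !coef_poly.
rewrite -[LHS]mulr_natr.
case: (ltngtP i N) => [iN|Ni|->].
- rewrite !ltnS iN (ltnW iN) mulr0 subr0 factS natrM invfM mulrAC mulVf ?mul1r //.
  exact: natr_neq0.
- by rewrite !ltnS (leqNgt i) Ni leqNgt (ltnW Ni : (N < i.+1)%N) /= mul0r mulr0 subr0.
- by rewrite ltnn ltnSn mul0r mulr1 subrr.
Qed.

Lemma deriv_logp N : (1 + 'X) * (logp N)^`() = 1 - (- 'X) ^+ N :> {poly k}.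
Proof.
have -> : (logp N)^`() = \sum_(i < N) (- 'X) ^+ i.
  apply/polyP => i; rewrite coef_deriv coefXM coef_poly coef_sum /=.
  rewrite (eq_bigr (fun j : 'I_N => if j == i :> nat then (-1) ^+ i else 0)); last first.
    move=> j _; rewrite (exprNn (polyX k)) -signr_odd mulr_sign -scaler_sign coefZ coefXn
      signr_odd eq_sym.
    by case: eqP => [->|_]; rewrite ?mulr1 ?mulr0.
  rewrite -big_mkcond /=; case: ltnP => iN.
    rewrite (big_pred1 (Ordinal iN)) // -[LHS]mulr_natr -mulrA mulVf ?mulr1 //.
    exact: natr_neq0.
  by rewrite mul0rn big_pred0 // => j; apply/negP => /eqP ji; rewrite -ji leqNgt ltn_ord in iN.
by rewrite -[RHS]opprB subrX1 -mulNr opprB opprK.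
Qed.

Lemma low_coef_factor n (p q : {poly k}) :
  (forall i, (i < n)%N -> p`_i = q`_i) -> exists r, p = q + r * 'X^n.
Proof.
move=> pq; exists (drop_poly n (p - q)).
rewrite -[p in LHS](subrK q) -[X in X + q](poly_take_drop n) addrC.
rewrite (_ : take_poly n _ = 0) ?add0r //; apply/polyP => i.
by rewrite coef_take_poly coef0; case: ifP => // /pq; rewrite coefB => ->; rewrite subrr.
Qed.

(** The composite p satisfies (1 + X) p' = p modulo X^N, and p(0) = 1. Comparing coefficients gives
    (j + 1) p_(j+1) = (1 - j) p_j for j < N, which forces the sequence 1, 1, 0, 0, ... *)
Lemma expp_logp N : exists r : {poly k}, expp N.+1 \Po logp N.+1 = 1 + 'X + r * 'X^(N.+1).
Proof.
set p := _ \Po _.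
have p0 : p`_0 = 1 by rewrite -horner_coef0 horner_comp logp0 expp0.
have dp : exists s, (1 + 'X) * p^`() = p + s * 'X^N.
  rewrite /p deriv_comp deriv_expp mulrCA deriv_logp comp_polyB comp_polyZ.
  rewrite /= comp_Xn_poly /logp exprMn exprNn (exprSr 'X).
  set P := _ \Po _; set l := \poly_(i < _) _.
  (* The witness collects the truncation errors of [deriv_expp] and [deriv_logp], each divisible by
     X^N. *)
  eexists (- ((N`!%:R)^-1 *: l ^+ N) * (1 - (-1) ^+ N.+1 * 'X^N * 'X) - P * (-1) ^+ N.+1 * 'X).
  rewrite -!mul_polyC; move: (_%:P) (_ ^+ _ : {poly k}) (l ^+ _) ('X^_) => a b c x.
  rewrite !(mulrBr, mulrBl, mulrDl, mulNr, mulrN, mulr1, opprB, opprK).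
  by rewrite !mulrA; ring.
have [s ds] := dp.
have rec j : (j < N)%N -> p`_j.+1 *+ j.+1 = p`_j - p`_j *+ j.
  move=> jN; apply/eqP; rewrite eq_sym subr_eq; apply/eqP.
  have := congr1 (fun q : {poly k} => q`_j) ds.
  rewrite /= [RHS]coefD coefMXn jN addr0 mulrDl mul1r coefD coefXM !coef_deriv => h;
    rewrite -[LHS]h {h}.
  by case: j {jN} => [|j] /=; rewrite ?mulr0n.
apply: low_coef_factor => i; rewrite ltnS coefD coef1 coefX.
case: i => [|[|i]] iN; first by rewrite p0 addr0.
  by have := rec 0 iN; rewrite p0 mulr0n subr0 (add0r 1).
rewrite addr0; elim: i iN => [|i IH] iN.
  have := rec 1 iN; rewrite (rec 0 (ltnW iN) : p`_1 = _) p0 mulr1n mulr0n subr0 subrr.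
  by rewrite -[LHS]mulr_natr => /eqP; rewrite mulf_eq0 (negbTE (natr_neq0 k0 _)) orbF => /eqP.
have := rec _ iN; rewrite IH ?(ltnW iN) // mul0rn subr0.
by rewrite -[LHS]mulr_natr => /eqP; rewrite mulf_eq0 (negbTE (natr_neq0 k0 _)) orbF => /eqP.
Qed.

(** For the composite q and e = exp X, the chain rule shows that X^N divides e (q' - 1). Since e has
    constant term 1 it is coprime to X^N, so q' = 1 modulo X^N, and q(0) = 0 fixes the rest. *)
Lemma logp_expp N : exists r : {poly k}, logp N.+1 \Po (expp N.+1 - 1) = 'X + r * 'X^(N.+1).
Proof.
set e := expp N.+1; set q := _ \Po _.
have e1 : exists s, e - 1 = s * 'X.
  have [|s es] := @low_coef_factor 1 e 1; last by exists s; rewrite {1}es addrC addKr.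
  by case=> // _; rewrite coef1 -horner_coef0 expp0.
have q0 : q`_0 = 0.
  rewrite -horner_coef0 horner_comp (_ : (e - 1).[0] = 0) ?logp0 //.
  by rewrite hornerD hornerN hornerC expp0 subrr.
have : exists s, e * (q^`() - 1) = s * 'X^N.
  have [s es] := e1.
  rewrite /q deriv_comp derivB derivC subr0.
  have -> : e * (((logp N.+1)^`() \Po (e - 1)) * e^`() - 1) =
     (((1 + 'X) * (logp N.+1)^`()) \Po (e - 1)) * e^`() - e.
    by rewrite comp_polyM comp_polyD comp_polyX -[1 \Po _]/(1%:P \Po _) comp_polyC (addrC
      1%:P) subrK mulrBr mulr1 mulrA.
  rewrite deriv_logp deriv_expp comp_polyB -[1 \Po _]/(1%:P \Po _) comp_polyC.
  rewrite exprNn comp_polyM comp_Xn_poly es exprMn (exprSr 'X) -signr_odd.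
  have -> : ((-1) ^+ odd N.+1 : {poly k}) \Po (s * 'X) = (-1) ^+ odd N.+1.
    by case: odd; rewrite ?expr0 ?expr1 -?[1]/(1%:P) -?polyCN comp_polyC.
  rewrite -/e -mul_polyC polyC1; move: (_ ^+ odd _) (_%:P) => a b.
  exists (- b - a * s ^+ N.+1 * 'X * (e - b * 'X^N)).
  by move: 'X^N => x; ring.
move=> [s hs].
have /dvdpP [r hr] : 'X^N %| q^`() - 1.
  rewrite -(Gauss_dvdpr _ (_ : coprimep 'X^N e)); first by rewrite hs dvdp_mull.
  rewrite coprimep_expl // coprimep_sym -[X in coprimep _ X]subr0 -[0]/(0%:P) coprimep_XsubC.
  by rewrite /root expp0 oner_neq0.
apply: low_coef_factor => -[|i] iN; first by rewrite q0 coefX.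
have := congr1 (fun q : {poly k} => q`_i) hr.
rewrite /= coefMXn -ltnS iN coefB coef_deriv coef1 => /eqP; rewrite subr_eq0 coefX eqSS.
case: i iN => [|i] iN /eqP; first by rewrite mulr1n.
by rewrite -[LHS]mulr_natr => /eqP; rewrite mulf_eq0 (negbTE (natr_neq0 k0 _)) orbF => /eqP.
Qed.

End ExpLogPoly.

Lemma triangle_sum (V : nmodType) N (G : nat -> nat -> V) :
  (forall i j, (N <= i + j)%N -> G i j = 0) ->
  \sum_(n < N) \sum_(i < n.+1) G i (n - i)%N = \sum_(i < N) \sum_(j < N) G i j.
Proof.
move=> G0.
transitivity (\sum_(n < N) \sum_(i < N | (i <= n)%N) G i (n - i)%N).
  apply: eq_bigr => n _; rewrite -(big_mkord xpredT (fun i => G i (n - i)%N)).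
  rewrite (big_nat_widen _ _ N) ?(ltn_ord n) // big_mkord.
  by apply: eq_bigl => i.
rewrite (exchange_big_dep xpredT) //=; apply: eq_bigr => i _.
rewrite -(big_mkord (fun n => i <= n)%N (fun n => G i (n - i)%N)).
rewrite big_mkcond (@big_cat_nat _ _ _ i) ?(ltnW (ltn_ord i)) //=.
rewrite big_nat big1 => [|n /andP[_ ni]]; last by rewrite leqNgt ni.
rewrite add0r -{1}[val i]add0n big_addn.
rewrite -[RHS](big_mkord xpredT) (@big_cat_nat _ _ _ (N - i) 0 N) ?leq_subr //=.
rewrite [X in _ + X]big_nat [X in _ + X]big1 ?addr0 => [|j /andP[ij _]]; last first.
  by rewrite G0 // -leq_subLR.
by apply: eq_bigr => j _; rewrite leq_addl addnK.
Qed.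

(** * Exponentials and logarithms of nilpotent elements of an algebra *)

Section DividedSums.
Context (k : fieldType) (k0 : has_pchar0 k).

(** Binomial coefficients divided by n! split as 1 / (i! (n - i)!), after which [triangle_sum]
    applies. It underlies both exp (a + b) = exp a exp b and its bilinear analogue
    [fexp_bilinear]. *)
Lemma divided_sum (V : lmodType k) N (F : nat -> nat -> V) :
  (forall i j, (N <= i + j)%N -> F i j = 0) ->
  \sum_(n < N) (n`!%:R : k)^-1 *: (\sum_(i < n.+1) F i (n - i)%N *+ 'C(n, i)) =
  \sum_(i < N) \sum_(j < N) ((i`!%:R : k)^-1 * (j`!%:R)^-1) *: F i j.
Proof.
move=> F0; rewrite -(triangle_sum (G := fun i j => ((i`!%:R)^-1 * (j`!%:R)^-1) *: F i j)).
  apply: eq_bigr => n _; rewrite scaler_sumr; apply: eq_bigr => i _.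
  rewrite -scaler_nat scalerA; congr (_ *: _).
  rewrite -(@bin_fact n i) -1?ltnS // !natrM !invfM [LHS]mulrC mulVKf //.
  by rewrite ((pcharf0P k).1 k0) -lt0n bin_gt0 -ltnS.
by move=> i j /F0 ->; rewrite scaler0.
Qed.

Context (A : algType k).

Definition hexp N (u : A) : A := \sum_(i < N) (i`!%:R : k)^-1 *: u ^+ i.
Definition hlog N (v : A) : A :=
  \sum_(m < N) ((-1) ^+ m / m.+1%:R : k) *: v ^+ m.+1.

Lemma horner_alg_poly (u : A) N (c : nat -> k) :
  horner_alg u (\poly_(i < N) c i) = \sum_(i < N) c i *: u ^+ i.
Proof.
rewrite poly_def linear_sum; apply: eq_bigr => i _.
by rewrite linearZ /= rmorphXn /= horner_algX mulr_algl.
Qed.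

Lemma horner_alg_comp (u : A) (p q : {poly k}) :
  horner_alg u (p \Po q) = horner_alg (horner_alg u q) p.
Proof.
elim/poly_ind: p => [|p c IH]; first by rewrite comp_poly0 !rmorph0.
rewrite comp_poly_MXaddC !(rmorphD, rmorphM) /= IH.
by rewrite !horner_algC horner_algX.
Qed.

Lemma hexpE N u : hexp N u = horner_alg u (expp k N).
Proof. by rewrite horner_alg_poly. Qed.

Lemma hlogE N u : hlog N u = horner_alg u (logp k N).
Proof.
rewrite rmorphM /= horner_algX horner_alg_poly mulr_sumr.
by apply: eq_bigr => i _; rewrite -scalerAr exprS.
Qed.

Lemma hexp_hlog N v : v ^+ N.+1 = 0 -> hexp N.+1 (hlog N.+1 v) = 1 + v.
Proof.
move=> v0; rewrite hexpE hlogE -horner_alg_comp.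
have [r ->] := expp_logp k0 N.
rewrite !(rmorphD, rmorphM, rmorph1, rmorphXn) /= horner_algX v0.
by rewrite mulr0 addr0.
Qed.

Lemma hlog_hexp N u : u ^+ N.+1 = 0 -> hlog N.+1 (hexp N.+1 u - 1) = u.
Proof.
move=> u0; have [r hr] := logp_expp k0 N.
have -> : hexp N.+1 u - 1 = horner_alg u (expp k N.+1 - 1).
  by rewrite rmorphB rmorph1 hexpE.
rewrite hlogE -horner_alg_comp hr.
by rewrite !(rmorphD, rmorphM, rmorphXn) /= horner_algX u0 mulr0 addr0.
Qed.

Lemma hexpD N (a b : A) : GRing.comm a b ->
  (forall i j, (N <= i + j)%N -> a ^+ i * b ^+ j = 0) ->
  hexp N (a + b) = hexp N a * hexp N b.
Proof.
move=> ab ab0; rewrite {1}/hexp mulr_suml.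
rewrite (eq_bigr (fun n : 'I_N => (n`!%:R : k)^-1 *: (\sum_(i < n.+1) (a ^+ i * b ^+ (n -
  i)) *+ 'C(n, i)))); last first.
  move=> n _; congr (_ *: _); rewrite addrC exprDn_comm; last exact/esym.
  apply: eq_bigr => i _; congr (_ *+ _).
  exact/commrX/esym/commrX.
rewrite (divided_sum (F := fun i j => a ^+ i * b ^+ j)) //; apply: eq_bigr => i _; rewrite
  mulr_sumr.
by apply: eq_bigr => j _; rewrite -scalerAl -scalerAr scalerA.
Qed.

Lemma hexp0 N : hexp N.+1 0 = 1.
Proof.
rewrite /hexp big_ord_recl big1 ?addr0 ?expr0 ?invr1 ?scale1r // => i _.
by rewrite expr0n scaler0.
Qed.

Lemma nilp_expr (u : A) N n : u ^+ N = 0 -> (N <= n)%N -> u ^+ n = 0.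
Proof. by move=> u0 /subnK <-; rewrite exprD u0 mulr0. Qed.

Lemma hexpN N (u : A) : u ^+ N.+1 = 0 -> hexp N.+1 u * hexp N.+1 (- u) = 1.
Proof.
move=> u0; rewrite -hexpD ?subrr ?hexp0 //; first exact/commrN.
move=> i j Nij; rewrite exprNn -signr_odd mulr_sign.
by case: odd; rewrite ?mulrN -exprD (nilp_expr u0) ?oppr0.
Qed.

End DividedSums.

Section AlgMorphism.
Context (k : fieldType) (A B : algType k) (f : {lrmorphism A -> B}).

Lemma rmorph_hexp N u : f (hexp N u) = hexp N (f u).
Proof. by rewrite linear_sum; apply: eq_bigr => i _; rewrite linearZ rmorphXn. Qed.

Lemma rmorph_hlog N u : f (hlog N u) = hlog N (f u).
Proof. by rewrite linear_sum; apply: eq_bigr => i _; rewrite linearZ rmorphXn. Qed.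

End AlgMorphism.

(** * Linear endomorphisms and polynomials in a central variable *)

(* The witness [v0] makes the ring nontrivial, as [algType] requires. *)
Record endo (k : fieldType) (V : lmodType k) (v0 : V) (nz : v0 != 0) :=
  Endo { endo_fun :> V -> V; endo_lin : linear endo_fun }.

Section Endo.
Context (k : fieldType) (V : lmodType k) (v0 : V) (nz : v0 != 0).
Local Notation E := (endo nz).

HB.instance Definition _ (u : E) :=
  GRing.isLinear.Build k V V *:%R (endo_fun u) (endo_lin u).

Lemma endoP (u v : E) : u =1 v -> u = v.
Proof.
case: u v => [u ul] [v vl] /= /funext uv; case: _ / uv vl => vl.
by congr Endo; apply: Prop_irrelevance.
Qed.

HB.instance Definition _ := gen_eqMixin E.
HB.instance Definition _ := gen_choiceMixin E.

Fact endo0_lin : linear (fun _ : V => 0 : V).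
Proof. by move=> a x y; rewrite scaler0 addr0. Qed.
Fact endo1_lin : linear (id : V -> V). Proof. by []. Qed.
Fact endoD_lin (u v : E) : linear (fun x => u x + v x).
Proof. by move=> a x y; rewrite !linearP scalerDr addrACA. Qed.
Fact endoN_lin (u : E) : linear (fun x => - u x).
Proof. by move=> a x y; rewrite linearP opprD scalerN. Qed.
Fact endoM_lin (u v : E) : linear (fun x => u (v x)).
Proof. by move=> a x y; rewrite !linearP. Qed.
Fact endoZ_lin (c : k) (u : E) : linear (fun x => c *: u x).
Proof. by move=> a x y; rewrite linearP scalerDr !scalerA mulrC. Qed.

Definition endo0 : E := Endo nz endo0_lin.
Definition endo1 : E := Endo nz endo1_lin.
Definition endoD (u v : E) : E := Endo nz (endoD_lin u v).
Definition endoN (u : E) : E := Endo nz (endoN_lin u).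
Definition endoM (u v : E) : E := Endo nz (endoM_lin u v).
Definition endoZ (c : k) (u : E) : E := Endo nz (endoZ_lin c u).

Fact endo_addA : associative endoD.
Proof. by move=> u v w; apply: endoP => x /=; rewrite addrA. Qed.
Fact endo_addC : commutative endoD.
Proof. by move=> u v; apply: endoP => x /=; rewrite addrC. Qed.
Fact endo_add0 : left_id endo0 endoD.
Proof. by move=> u; apply: endoP => x /=; rewrite add0r. Qed.
Fact endo_addN : left_inverse endo0 endoN endoD.
Proof. by move=> u; apply: endoP => x /=; rewrite addNr. Qed.

HB.instance Definition _ :=
  GRing.isZmodule.Build E endo_addA endo_addC endo_add0 endo_addN.

Fact endo_mulA : associative endoM.
Proof. by move=> u v w; apply: endoP. Qed.
Fact endo_mul1 : left_id endo1 endoM.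
Proof. by move=> u; apply: endoP. Qed.
Fact endo_mulr1 : right_id endo1 endoM.
Proof. by move=> u; apply: endoP. Qed.
Fact endo_mulDl : left_distributive endoM endoD.
Proof. by move=> u v w; apply: endoP. Qed.
Fact endo_mulDr : right_distributive endoM endoD.
Proof. by move=> u v w; apply: endoP => x /=; rewrite linearD. Qed.
Fact endo_one : endo1 != 0.
Proof. by apply/eqP => /(congr1 (fun u : E => u v0)) /= v00; move: nz; rewrite v00 eqxx. Qed.

HB.instance Definition _ := GRing.Zmodule_isNzRing.Build E
  endo_mulA endo_mul1 endo_mulr1 endo_mulDl endo_mulDr endo_one.

Fact endo_scaleA a b u : endoZ a (endoZ b u) = endoZ (a * b) u.
Proof. by apply: endoP => x /=; rewrite scalerA. Qed.
Fact endo_scale1 : left_id 1 endoZ.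
Proof. by move=> u; apply: endoP => x /=; rewrite scale1r. Qed.
Fact endo_scaleDr : right_distributive endoZ +%R.
Proof. by move=> a u v; apply: endoP => x /=; rewrite scalerDr. Qed.
Fact endo_scaleDl u : {morph endoZ^~ u : a b / a + b}.
Proof. by move=> a b; apply: endoP => x /=; rewrite scalerDl. Qed.

HB.instance Definition _ := GRing.Zmodule_isLmodule.Build k E
  endo_scaleA endo_scale1 endo_scaleDr endo_scaleDl.

Fact endo_scaleAl (c : k) (u v : E) : c *: (u * v) = (c *: u) * v.
Proof. by apply: endoP. Qed.
Fact endo_scaleAr (c : k) (u v : E) : c *: (u * v) = u * (c *: v).
Proof. by apply: endoP => x /=; rewrite linearZ. Qed.

HB.instance Definition _ := GRing.Lmodule_isLalgebra.Build k E endo_scaleAl.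
HB.instance Definition _ := GRing.Lalgebra_isAlgebra.Build k E endo_scaleAr.

Lemma endo_mulE (u v : E) x : (u * v) x = u (v x). Proof. by []. Qed.
Lemma endo_scaleE (c : k) (u : E) x : (c *: u) x = c *: u x. Proof. by []. Qed.
Lemma endo_sumE I (r : seq I) P (u : I -> E) x :
  (\sum_(i <- r | P i) u i) x = \sum_(i <- r | P i) u i x.
Proof. by elim/big_rec2: _ => // i y z _ <-. Qed.
Lemma endo_expE (u : E) n x : (u ^+ n) x = iter n u x.
Proof. by elim: n => // n IH; rewrite exprS endo_mulE IH. Qed.
End Endo.

(* [{poly B}] as an algebra over [k] instead of over [B]. *)
Definition tpoly (k : fieldType) (B : algType k) := {poly B}.

Section TPoly.
Context (k : fieldType) (B : algType k).
Local Notation S := (tpoly B).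

HB.instance Definition _ := GRing.NzRing.on S.

Definition tscale (a : k) (p : S) : S := (a%:A : B) *: (p : {poly B}).

Fact tscaleA a b u : tscale a (tscale b u) = tscale (a * b) u.
Proof. by rewrite /tscale scalerA mulr_algl scalerA. Qed.
Fact tscale1 : left_id 1 tscale.
Proof. by move=> u; rewrite /tscale !scale1r. Qed.
Fact tscaleDr : right_distributive tscale +%R.
Proof. by move=> a u v; exact: scalerDr. Qed.
Fact tscaleDl u : {morph tscale^~ u : a b / a + b}.
Proof. by move=> a b; rewrite /tscale !scalerDl. Qed.

HB.instance Definition _ := GRing.Zmodule_isLmodule.Build k S
  tscaleA tscale1 tscaleDr tscaleDl.

Lemma coef_tscale (a : k) (p : S) i : (a *: p : S)`_i = a *: p`_i.
Proof. by rewrite [LHS]coefZ mulr_algl. Qed.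

Fact tscaleAl (c : k) (u v : S) : c *: (u * v) = (c *: u) * v.
Proof. exact: scalerAl. Qed.
Fact tscaleAr (c : k) (u v : S) : c *: (u * v) = u * (c *: v).
Proof.
apply/polyP => i; rewrite coef_tscale !coefM scaler_sumr.
by apply: eq_bigr => j _; rewrite coef_tscale scalerAr.
Qed.

HB.instance Definition _ := GRing.Lmodule_isLalgebra.Build k S tscaleAl.
HB.instance Definition _ := GRing.Lalgebra_isAlgebra.Build k S tscaleAr.

Definition ev0 (p : S) : B := p`_0.
Definition ev1 (p : S) : B := (p : {poly B}).[1].

Fact ev0_linear : linear ev0.
Proof. by move=> a p q; rewrite /ev0 coefD coef_tscale. Qed.
HB.instance Definition _ := GRing.isLinear.Build k S B *:%R ev0 ev0_linear.
Fact ev0_mul : monoid_morphism ev0.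
Proof. by split=> [|p q]; rewrite /ev0 ?coef1 // coef0M. Qed.
HB.instance Definition _ := GRing.isMonoidMorphism.Build S B ev0 ev0_mul.

Fact ev1_linear : linear ev1.
Proof. by move=> a p q; rewrite /ev1 hornerD hornerZ mulr_algl. Qed.
HB.instance Definition _ := GRing.isLinear.Build k S B *:%R ev1 ev1_linear.
Fact ev1_mul : monoid_morphism ev1.
Proof.
split=> [|p q]; rewrite /ev1 ?hornerC // hornerM_comm //.
by rewrite /comm_poly mulr1 mul1r.
Qed.
HB.instance Definition _ := GRing.isMonoidMorphism.Build S B ev1 ev1_mul.

Definition tmul (x : B) : S := x%:P * 'X.

Lemma coef_tmul x i : (tmul x)`_i = if i == 1 then x else 0.
Proof. by rewrite coefMX coefC; case: i => [|[|i]]. Qed.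

Lemma ev0_tmul x : ev0 (tmul x) = 0.
Proof. by rewrite /ev0 coef_tmul. Qed.

Lemma ev1_tmul x : ev1 (tmul x) = x.
Proof. by rewrite /ev1 hornerMX hornerC mulr1. Qed.

(** The Euler derivation E = t d/dt, which multiplies the coefficient of t^n by n. *)
Definition euler (p : S) : S := (p : {poly B})^`() * 'X.

Lemma coef_euler p i : (euler p)`_i = p`_i *+ i.
Proof. by rewrite coefMX coef_deriv; case: i. Qed.

Fact euler_linear : linear euler.
Proof.
move=> a p q; apply/polyP => i; rewrite coefD coef_euler coefD coef_tscale.
by rewrite coef_tscale !coef_euler mulrnDl scalerMnr.
Qed.
HB.instance Definition _ := GRing.isLinear.Build k S S *:%R euler euler_linear.

Lemma eulerM p q : euler (p * q) = euler p * q + p * euler q.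
Proof. by rewrite /euler derivM mulrDl -!mulrA (commr_polyX q). Qed.

Lemma euler1 : euler 1 = 0.
Proof. by rewrite /euler derivC mul0r. Qed.

Lemma euler_tmul x : euler (tmul x) = tmul x.
Proof. by apply/polyP => i; rewrite coef_euler !coef_tmul; case: eqP => [->|_]; rewrite
  ?mul0rn. Qed.

End TPoly.

(** * Dynkin's form of the Baker-Campbell-Hausdorff formula *)

Section GenericBCH.
Context (k : fieldType) (L : lmodType k) (br : L -> L -> L).

(** [nbr] and [bcht] restate [nested_br] and [bch_term] for an arbitrary bracket, so that Dynkin's
    formula can be proved for commutators and carried along bracket-preserving maps. *)
Fixpoint nbr (w : seq L) : L :=
  match w with
  | [::] => 0
  | x :: w' => if w' is [::] then x else br x (nbr w')
  end.

Definition bcht (x y : L) (n : nat) : L :=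
  \sum_(m < n) \sum_(p : {ffun 'I_m.+1 -> 'I_n.+1 * 'I_n.+1} |
         [forall i, 0 < (p i).1 + (p i).2]%N
         && (\sum_i ((p i).1 + (p i).2) == n)%N)
    ((-1) ^+ m / (m.+1%:R * n%:R * \prod_i ((p i).1`! * (p i).2`!)%:R) : k) *:
      nbr (flatten [seq nseq (p i).1 x ++ nseq (p i).2 y | i <- enum 'I_m.+1]).

End GenericBCH.

(** The total weight n already bounds every exponent by n, so enlarging the range of the exponents
    adds no index to the sum. *)
Lemma ffun_sum_widen (V : nmodType) K n m (G : ('I_m -> nat * nat) -> V) :
  (n < K)%N ->
  \sum_(p : {ffun 'I_m -> 'I_K * 'I_K} |
         [forall i, 0 < (p i).1 + (p i).2]%N
         && (\sum_i ((p i).1 + (p i).2) == n)%N)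
     G (fun i => (val (p i).1, val (p i).2)) =
  \sum_(p : {ffun 'I_m -> 'I_n.+1 * 'I_n.+1} |
         [forall i, 0 < (p i).1 + (p i).2]%N
         && (\sum_i ((p i).1 + (p i).2) == n)%N)
     G (fun i => (val (p i).1, val (p i).2)).
Proof.
move=> nK.
pose h (p : {ffun 'I_m -> 'I_n.+1 * 'I_n.+1}) : {ffun 'I_m -> 'I_K * 'I_K} :=
  [ffun i => (widen_ord nK (p i).1, widen_ord nK (p i).2)].
pose h' (p : {ffun 'I_m -> 'I_K * 'I_K}) : {ffun 'I_m -> 'I_n.+1 * 'I_n.+1} :=
  [ffun i => (inord (p i).1, inord (p i).2)].
rewrite (reindex_onto h h') /=; last first.
  move=> p /andP[_ /eqP sp]; apply/ffunP => i; rewrite !ffunE.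
  have : ((p i).1 + (p i).2 <= n)%N by rewrite -sp (bigD1 i) //= leq_addr.
  move=> le; case: (p i) le => a b /= le.
  by congr (_, _); apply: val_inj; rewrite /= inordK //; lia.
apply: eq_big => [p|p _]; last by congr G; apply: funext => i; rewrite ffunE.
have -> : h' (h p) == p.
  apply/eqP/ffunP => i; rewrite !ffunE; case: (p i) => a b /=.
  by congr (_, _); apply: val_inj; rewrite /= inordK.
rewrite andbT; congr (_ && _).
  by apply: eq_forallb => i; rewrite ffunE.
by congr (_ == _); apply: eq_bigr => i _; rewrite ffunE.
Qed.

(** * Algebras with a multiplicative filtration of finite length *)

Section NFilt.
Context (k : fieldType) (A : algType k).

(** A decreasing multiplicative filtration that vanishes at step [N]. Elements of [J 1] have zero
    [N]-th power, so their truncated exponentials and logarithms are exact. *)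
Record nfilt (N : nat) (J : nat -> A -> Prop) : Prop := NFilt {
  nf_lin : forall n a x y, J n x -> J n y -> J n (a *: x + y);
  nf_zero : forall n, J n 0;
  nf_one : J 0%N 1;
  nf_mul : forall m n x y, J m x -> J n y -> J (m + n)%N (x * y);
  nf_anti : forall n x, J n.+1 x -> J n x;
  nf_nil : forall x, J N x -> x = 0
}.

Context (N : nat) (J : nat -> A -> Prop) (JF : nfilt N J).

Lemma nfD n x y : J n x -> J n y -> J n (x + y).
Proof. by move=> Jx Jy; rewrite -[x]scale1r; apply: (nf_lin JF). Qed.

Lemma nfZ n a x : J n x -> J n (a *: x).
Proof. by move=> Jx; rewrite -[_ *: _]addr0; apply: (nf_lin JF) => //; apply: (nf_zero JF). Qed.

Lemma nfN n x : J n x -> J n (- x).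
Proof. by rewrite -scaleN1r; apply: nfZ. Qed.

Lemma nfB n x y : J n x -> J n y -> J n (x - y).
Proof. by move=> Jx /nfN; apply: nfD. Qed.

Lemma nf_sum n I (r : seq I) (P : pred I) (F : I -> A) :
  (forall i, P i -> J n (F i)) -> J n (\sum_(i <- r | P i) F i).
Proof. by move=> JFi; elim/big_ind: _ => //; [apply: (nf_zero JF)|apply: nfD]. Qed.

Lemma nfW m n x : (m <= n)%N -> J n x -> J m x.
Proof.
move=> /subnK <-; elim: (n - m)%N => // d IH /(nf_anti JF); exact: IH.
Qed.

Lemma nfX m x n : J m x -> J (n * m)%N (x ^+ n).
Proof.
move=> Jx; elim: n => [|n IH]; first by rewrite expr0 mul0n; apply: (nf_one JF).
by rewrite exprS mulSn; apply: (nf_mul JF).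
Qed.

Lemma nfX1 x n : J 1%N x -> J n (x ^+ n).
Proof. by move/(@nfX _ _ n); rewrite muln1. Qed.

Lemma nf_expr0 x n : J 1%N x -> (N <= n)%N -> x ^+ n = 0.
Proof. by move=> Jx Nn; apply: (nf_nil JF); apply: nfW Nn _; apply: nfX1. Qed.

Lemma nf_hexp M x : J 1%N x -> J 1%N (hexp M.+1 x - 1).
Proof.
move=> Jx; rewrite /hexp big_ord_recl expr0 fact0 invr1 scale1r addrC addKr.
by apply: nf_sum => i _; apply: nfZ; apply: nfW (nfX1 _ Jx).
Qed.

Lemma nf_hlog M x : J 1%N x -> J 1%N (hlog M x).
Proof. by move=> Jx; apply: nf_sum => i _; apply: nfZ; apply: nfW (nfX1 _ Jx). Qed.

Lemma nf_mul1 x y : J 1%N (x - 1) -> J 1%N (y - 1) -> J 1%N (x * y - 1).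
Proof.
move=> Jx Jy; have -> : x * y - 1 = (x - 1) * y + (y - 1).
  by rewrite mulrBl mul1r addrA subrK.
apply: nfD => //; rewrite -[1%N]addn0; apply: (nf_mul JF) => //.
rewrite -[y](subrK 1); apply: nfD; [exact: nfW Jy|exact: (nf_one JF)].
Qed.

Definition comm (x y : A) : A := x * y - y * x.

Lemma nf_comm m n x y : J m x -> J n y -> J (m + n)%N (comm x y).
Proof. by move=> Jx Jy; apply: nfB; [|rewrite addnC]; apply: (nf_mul JF). Qed.

Lemma nf_nbr w : {in w, forall x, J 1%N x} -> J (size w) (nbr comm w).
Proof.
elim: w => [|x [|y w] IH] Jw; first exact: (nf_zero JF).
  by apply: Jw; rewrite inE.
apply: (@nf_comm 1); first by apply: Jw; rewrite mem_head.
by apply: IH => z zw; apply: Jw; rewrite inE zw orbT.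
Qed.

End NFilt.

Arguments comm {k A} x y.

Section TPolyFilt.
Context (k : fieldType) (A : algType k) (N : nat) (J : nat -> A -> Prop).
Context (JF : nfilt N J).

Definition tfilt n (p : tpoly A) := forall i, J n p`_i.

Lemma tfiltP : nfilt N tfilt.
Proof.
split=> [n a x y Jx Jy i|n i|i|m n x y Jx Jy i|n x Jx i|x Jx].
- by rewrite coefD coef_tscale; apply: (nf_lin JF).
- by rewrite coef0; apply: (nf_zero JF).
- by rewrite coef1; case: eqP => _; [apply: (nf_one JF)|apply: (nf_zero JF)].
- by rewrite coefM; apply: (nf_sum JF) => j _; apply: (nf_mul JF).
- exact: (nf_anti JF).
- by apply/polyP => i; rewrite coef0; apply: (nf_nil JF).
Qed.

Lemma tfilt_tmul n x : J n x -> tfilt n (tmul x).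
Proof. by move=> Jx i; rewrite coef_tmul; case: eqP => // _; apply: (nf_zero JF). Qed.

End TPolyFilt.

Section LogExpExpand.
Context (k : fieldType) (A : algType k).

(** Subtracting 1 removes the pair (0, 0) from the double series exp a exp b. Distributing the power
    m + 1 over the remaining pairs gives the index set and the words of Dynkin's formula. *)
Lemma hlog_hexp_expand K (a b : A) :
  hlog K (hexp K a * hexp K b - 1) =
  \sum_(m < K) \sum_(p : {ffun 'I_m.+1 -> 'I_K * 'I_K} |
       [forall i, 0 < (p i).1 + (p i).2]%N)
    ((-1) ^+ m / (m.+1%:R * \prod_i ((p i).1`! * (p i).2`!)%:R) : k) *:
     \prod_(x <- flatten [seq nseq (p i).1 a ++ nseq (p i).2 b | i <- enum 'I_m.+1]) x.
Proof.
apply: eq_bigr => m _.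
have K0 : (0 < K)%N by apply: leq_ltn_trans (ltn_ord m).
have -> : hexp K a * hexp K b - 1 =
    \sum_(rs : 'I_K * 'I_K | (0 < rs.1 + rs.2)%N)
      ((rs.1`! * rs.2`!)%:R : k)^-1 *: (a ^+ rs.1 * b ^+ rs.2).
  rewrite mulr_suml.
  under eq_bigr => i _ do rewrite mulr_sumr.
  rewrite pair_big /= (bigD1 (Ordinal K0, Ordinal K0)) //=.
  rewrite !expr0 fact0 invr1 !scale1r mulr1 addrC addrK.
  apply: eq_big => [[[r rK] [s sK]]|[r s] _] /=.
    by rewrite -pair_eqE /= -!val_eqE /=; case: r s {rK sK} => [|r] [|s].
  by rewrite -scalerAl -scalerAr scalerA natrM invfM.
have -> (v : A) : v ^+ m.+1 = \prod_(i < m.+1) v by rewrite prodr_const card_ord.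
rewrite bigA_distr_big scaler_sumr; apply: eq_big => [p|p _].
  by apply/ffun_onP/forallP => h i; have := h i.
have -> : \prod_i (((p i).1`! * (p i).2`!)%:R^-1 *: (a ^+ (p i).1 * b ^+ (p i).2)) =
    (\prod_i ((p i).1`! * (p i).2`!)%:R : k)^-1 *: (\prod_i (a ^+ (p i).1 * b ^+ (p i).2)).
  by rewrite scaler_prod prodfV.
rewrite scalerA -mulrA -invfM; congr (_ *: _).
rewrite big_flatten big_map enumT [index_enum _]unlock; apply: eq_bigr => i _.
by rewrite big_cat !big_nseq -!Monoid.iteropE.
Qed.
End LogExpExpand.

(* The pair [(v, c)] stands for the operator [v - c t d/dt] on power series; [lop]
   and [rop] are multiplication by a series on the left and on the right. *)
Section EulerExtension.
Context (k : fieldType) (B : algType k).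
Local Notation S := (tpoly B).

Fact meuler_neq0 : (0, 1) != 0 :> S * S.
Proof. by rewrite xpair_eqE eqxx oner_neq0. Qed.
Local Notation W := (endo meuler_neq0).

Fact lop_lin (u : S) : linear (fun q : S * S => (u * q.1, u * q.2)).
Proof. by move=> a x y; congr (_, _); rewrite /= mulrDr -scalerAr. Qed.
Fact rop_lin (u : S) : linear (fun q : S * S => (q.1 * u - q.2 * euler u, q.2 * u)).
Proof.
move=> a x y; congr (_, _); rewrite /= !mulrDl -!scalerAl //.
by rewrite scalerBr opprD addrACA.
Qed.

Definition lop (u : S) : W := Endo meuler_neq0 (lop_lin u).
Definition rop (u : S) : W := Endo meuler_neq0 (rop_lin u).
Definition adop (u : S) : W := lop u - rop u.

Lemma lop_is_linear : linear lop.
Proof.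
by move=> a u v; apply: endoP => q; congr (_, _); rewrite /= mulrDl -scalerAl.
Qed.
HB.instance Definition _ := GRing.isLinear.Build k S W *:%R lop lop_is_linear.
Lemma rop_is_linear : linear rop.
Proof.
move=> a u v; apply: endoP => q; congr (_, _); rewrite /= ?linearP /= !mulrDr -!scalerAr //.
by rewrite scalerBr opprD addrACA.
Qed.
HB.instance Definition _ := GRing.isLinear.Build k S W *:%R rop rop_is_linear.

Lemma lopM u v : lop (u * v) = lop u * lop v.
Proof. by apply: endoP => q; congr (_, _); rewrite /= mulrA. Qed.
Lemma lop1 : lop 1 = 1.
Proof. by apply: endoP => -[v c]; congr (_, _); rewrite /= mul1r. Qed.
Lemma ropM u v : rop (u * v) = rop v * rop u.
Proof.
apply: endoP => q; congr (_, _); last by rewrite /= mulrA.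
rewrite /= eulerM mulrDr mulrBl opprD.
by rewrite !mulrA addrA.
Qed.
Lemma rop1 : rop 1 = 1.
Proof. by apply: endoP => -[v c]; congr (_, _); rewrite /= ?mulr1 // euler1 mulr0 subr0. Qed.
Lemma lop_rop u v : GRing.comm (lop u) (rop v).
Proof. by apply: endoP => q; congr (_, _); rewrite /= ?mulrBr !mulrA. Qed.

Lemma lopX u n : lop (u ^+ n) = lop u ^+ n.
Proof. by elim: n => [|n IH]; rewrite ?lop1 // !exprS lopM IH. Qed.
Lemma ropX u n : rop (u ^+ n) = rop u ^+ n.
Proof. by elim: n => [|n IH]; rewrite ?rop1 // exprSr exprS ropM IH. Qed.

Lemma lop_hexp K u : lop (hexp K u) = hexp K (lop u).
Proof. by rewrite linear_sum; apply: eq_bigr => i _; rewrite linearZ /= lopX. Qed.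
Lemma rop_hexp K u : rop (hexp K u) = hexp K (rop u).
Proof. by rewrite linear_sum; apply: eq_bigr => i _; rewrite linearZ /= ropX. Qed.

(** The pair (0, 1) is - E, and [u, - E] = E u. *)
Lemma adop0 u : adop u (0, 1) = (euler u, 0).
Proof. by congr (_, _); rewrite /= ?mulr0 ?mul0r ?mulr1 ?mul1r ?add0r ?opprK ?subrr. Qed.

Lemma adop_comm u v : adop u (v, 0) = (comm u v, 0).
Proof. by congr (_, _); rewrite /= ?mulr0 ?mul0r ?oppr0 ?addr0 // subr0. Qed.

Context (k0 : has_pchar0 k) (N M : nat) (J : nat -> B -> Prop) (JF : nfilt N J).
Hypothesis NM : (N.*2 <= M.+1)%N.
Let TF := tfiltP JF.

(** Left and right factors are each nilpotent of order [N]. If i + j is at least 2 N, one exponent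
    reaches [N]; this is the origin of the bound on [M]. *)
Lemma lop_rop0 u v i j : tfilt J 1 u -> tfilt J 1 v -> (M.+1 <= i + j)%N ->
  lop u ^+ i * rop v ^+ j = 0.
Proof.
move=> Ju Jv ij; rewrite -lopX -ropX.
case: (leqP N i) => Ni; first by rewrite (nf_expr0 TF Ju Ni) linear0 mul0r.
by rewrite (nf_expr0 TF Jv (_ : N <= j)%N) ?linear0 ?mulr0 //; lia.
Qed.

(** Conjugation by exp u is exp (ad u): left and right multiplications commute, so the exponential
    of their difference splits. *)
Lemma hexp_adop u : tfilt J 1 u ->
  hexp M.+1 (adop u) = lop (hexp M.+1 u) * rop (hexp M.+1 (- u)).
Proof.
move=> Ju; rewrite lop_hexp rop_hexp linearN -hexpD //; first exact/commrN/lop_rop.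
move=> i j ij; rewrite -linearN lop_rop0 //.
exact: (nfN TF).
Qed.

Lemma adop_nil u : tfilt J 1 u -> adop u ^+ M.+1 = 0.
Proof.
move=> Ju; rewrite /adop -linearN addrC exprDn_comm; last exact/esym/lop_rop.
rewrite big1 // => i _; rewrite -[X in X *+ _]/(_ * _).
rewrite (commrX _ (commr_sym (commrX _ (lop_rop u (- u))))).
rewrite lop_rop0 ?mul0rn //; first exact: (nfN TF).
by have := ltn_ord i; lia.
Qed.

(** With D = log (exp u exp v), conjugation by exp D is the composite of the conjugations by exp u
    and exp v, that is, exp (ad D) = exp (ad u) exp (ad v). Nilpotency of [adop D] allows taking
    logarithms. *)
Lemma hlog_adop (u v : S) : tfilt J 1 u -> tfilt J 1 v ->
  hlog M.+1 (hexp M.+1 (adop u) * hexp M.+1 (adop v) - 1) =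
  adop (hlog M.+1 (hexp M.+1 u * hexp M.+1 v - 1)).
Proof.
move=> Ju Jv; set D := (X in _ = adop X).
have NM1 : (N <= M.+1)%N by lia.
have JG : tfilt J 1 (hexp M.+1 u * hexp M.+1 v - 1).
  by apply: (nf_mul1 TF); apply: (nf_hexp TF).
have JD : tfilt J 1 D by apply: (nf_hlog TF).
have expD : hexp M.+1 D = hexp M.+1 u * hexp M.+1 v.
  by rewrite hexp_hlog ?(nf_expr0 TF JG NM1) // addrC subrK.
have inv w : tfilt J 1 w -> hexp M.+1 w * hexp M.+1 (- w) = 1.
  by move=> Jw; apply: hexpN => //; apply: (nf_expr0 TF Jw NM1).
have expND : hexp M.+1 (- D) = hexp M.+1 (- v) * hexp M.+1 (- u).
  have JND : tfilt J 1 (- D) by apply: (nfN TF).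
  have := inv _ JND; rewrite opprK => ND.
  rewrite -[RHS]mul1r -ND expD -!mulrA (mulrA (hexp _ v)) inv // mul1r.
  by rewrite inv // mulr1.
rewrite !hexp_adop // -[RHS](hlog_hexp k0 (N := M)) ?adop_nil // hexp_adop //.
rewrite expD expND lopM ropM; congr (hlog _ (_ - 1)).
rewrite -!mulrA; congr (_ * _); rewrite !mulrA; congr (_ * _).
exact/esym/lop_rop.
Qed.

(** The innermost letter meets - E and returns itself, because E fixes monomials of degree 1; every
    further letter acts by a commutator. *)
Lemma adop_word (X Y : B) (w : seq bool) : w != [::] ->
  (\prod_(x <- map (fun b : bool => if b then adop (tmul X) else adop (tmul Y)) w) x) (0, 1) =
  (nbr comm (map (fun b : bool => tmul (if b then X else Y)) w), 0).
Proof.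
elim: w => // b [|b' w] IH _; rewrite /= big_cons.
  by rewrite big_nil mulr1; case: b; rewrite adop0 euler_tmul.
rewrite endo_mulE IH //; case: b; exact: adop_comm.
Qed.

(** A nested commutator of n letters of degree 1 in the central variable t is a monomial of degree
    n. *)
Lemma coef_nbr_tmul (X Y : B) (w : seq bool) i :
  (nbr comm (map (fun b : bool => tmul (if b then X else Y)) w))`_i =
  if i == size w then nbr comm (map (fun b : bool => if b then X else Y) w) else 0.
Proof.
pose mon (x : B) n : S := x%:P * 'X^n.
have mon_comm x y m n : comm (mon x m) (mon y n) = mon (comm x y) (m + n)%N.
  have monM x' y' m' n' : mon x' m' * mon y' n' = mon (x' * y') (m' + n')%N.
    rewrite /mon mulrA -(mulrA x'%:P) -(commr_polyXn y'%:P m') mulrA -polyCM.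
    by rewrite -mulrA -exprD.
  by rewrite /comm !monM /mon polyCB mulrBl [(n + m)%N]addnC.
suff -> : nbr comm (map (fun b : bool => tmul (if b then X else Y)) w) =
    mon (nbr comm (map (fun b : bool => if b then X else Y) w)) (size w).
  by rewrite coefCM coefXn; case: eqP; rewrite ?mulr1 ?mulr0.
elim: w => [|b [|b' w] IH] //; first by rewrite /mon polyC0 mul0r.
have -> : nbr comm [seq tmul (if b then X else Y) | b <- b :: b' :: w] =
  comm (tmul (if b then X else Y)) (nbr comm [seq tmul (if b then X else Y) | b <- b' ::
    w]) by [].
by rewrite IH -[tmul _]/(mon _ 1%N) mon_comm.
Qed.

End EulerExtension.

Definition bword m (p : 'I_m -> nat * nat) : seq bool :=
  flatten [seq nseq (p i).1 true ++ nseq (p i).2 false | i <- enum 'I_m].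

Lemma map_bword T (f : bool -> T) m (p : 'I_m -> nat * nat) :
  map f (bword p) =
  flatten [seq nseq (p i).1 (f true) ++ nseq (p i).2 (f false) | i <- enum 'I_m].
Proof.
rewrite map_flatten -map_comp; congr flatten; apply: eq_map => i /=.
by rewrite map_cat !map_nseq.
Qed.

Lemma size_bword m (p : 'I_m -> nat * nat) :
  size (bword p) = (\sum_i ((p i).1 + (p i).2))%N.
Proof.
rewrite size_flatten sumnE /shape big_map big_map big_enum.
by apply: eq_bigr => i _; rewrite /= size_cat !size_nseq.
Qed.

Lemma bcht_bword (k : fieldType) (L : lmodType k) (br : L -> L -> L) x y n :
  bcht br x y n =
  \sum_(m < n) \sum_(p : {ffun 'I_m.+1 -> 'I_n.+1 * 'I_n.+1} |
         [forall i, 0 < (p i).1 + (p i).2]%N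
         && (\sum_i ((p i).1 + (p i).2) == n)%N)
    ((-1) ^+ m / (m.+1%:R * n%:R * \prod_i ((p i).1`! * (p i).2`!)%:R) : k) *:
      nbr br (map (fun b : bool => if b then x else y)
        (bword (fun i => (val (p i).1, val (p i).2)))).
Proof.
by apply: eq_bigr => m _; apply: eq_bigr => p _; rewrite map_bword.
Qed.

Section Dynkin.
Context (k : fieldType) (B : algType k) (k0 : has_pchar0 k) (N M : nat).
Context (J : nat -> B -> Prop) (JF : nfilt N J).
Hypothesis NM : (N.*2 <= M.+1)%N.

(** The left side is a coefficient of [euler D], the first component of [adop D] at (0, 1). By
    [hlog_adop] this operator is a logarithm of exponentials of [adop]; its expansion into words
    contributes one nested commutator per word, in the degree given by the length. *)
Lemma coef_hlog_tmul (X Y : B) n : J 1%N X -> J 1%N Y ->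
  (hlog M.+1 (hexp M.+1 (tmul X) * hexp M.+1 (tmul Y) - 1))`_n *+ n =
  \sum_(m < M.+1) \sum_(p : {ffun 'I_m.+1 -> 'I_M.+1 * 'I_M.+1} |
         [forall i, 0 < (p i).1 + (p i).2]%N
         && (\sum_i ((p i).1 + (p i).2) == n)%N)
    ((-1) ^+ m / (m.+1%:R * \prod_i ((p i).1`! * (p i).2`!)%:R) : k) *:
      nbr comm (map (fun b : bool => if b then X else Y)
        (bword (fun i => (val (p i).1, val (p i).2)))).
Proof.
move=> JX JY; set D := hlog _ _.
rewrite -coef_euler -[euler D]/((euler D, 0 : tpoly B).1) -adop0.
rewrite -(hlog_adop k0 JF NM) ?hlog_hexp_expand; try exact: (tfilt_tmul JF).
rewrite endo_sumE raddf_sum coef_sum; apply: eq_bigr => m _.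
rewrite endo_sumE raddf_sum coef_sum big_mkcondr; apply: eq_bigr => p p0.
pose q i := (val (p i).1, val (p i).2).
rewrite -[flatten _](map_bword (fun b : bool => if b then adop (tmul X) else adop (tmul Y)) q).
rewrite endo_scaleE adop_word; last first.
  rewrite -size_eq0 size_bword -lt0n big_ord_recl /=.
  by have /forallP/(_ ord0) := p0; rewrite /q; lia.
rewrite /= coef_tscale coef_nbr_tmul size_bword eq_sym.
by case: ifP => // _; rewrite scaler0.
Qed.

Lemma coef_dynkin (X Y : B) n : J 1%N X -> J 1%N Y -> (0 < n < M.+1)%N ->
  (hlog M.+1 (hexp M.+1 (tmul X) * hexp M.+1 (tmul Y) - 1))`_n = bcht comm X Y n.
Proof.
move=> JX JY /andP[n0 nM].
have nk : n%:R != 0 :> k by case: n n0 {nM} => // n _; exact: natr_neq0.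
apply: (scalerI nk); rewrite scaler_nat coef_hlog_tmul // bcht_bword scaler_sumr.
rewrite (big_ord_widen _ (fun m => n%:R *: \sum_(p : {ffun 'I_m.+1 -> 'I_n.+1 * 'I_n.+1} |
         [forall i, 0 < (p i).1 + (p i).2]%N
         && (\sum_i ((p i).1 + (p i).2) == n)%N)
    ((-1) ^+ m / (m.+1%:R * n%:R * \prod_i ((p i).1`! * (p i).2`!)%:R) : k) *:
      nbr comm (map (fun b : bool => if b then X else Y)
        (bword (fun i => (val (p i).1, val (p i).2))))) (ltnW nM)).
rewrite [RHS]big_mkcond; apply: eq_bigr => m _.
pose G (q : 'I_m.+1 -> nat * nat) := ((-1) ^+ m / (m.+1%:R * \prod_i ((q i).1`! * (q
  i).2`!)%:R) : k) *:
      nbr comm (map (fun b : bool => if b then X else Y) (bword q)).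
rewrite (ffun_sum_widen G nM); case: ltnP => mn.
  rewrite scaler_sumr; apply: eq_bigr => p _.
  rewrite scalerA /G; congr (_ *: _).
  by rewrite mulrCA; congr (_ * _); rewrite (mulrC _ n%:R) -mulrA [in RHS]invfM mulVKf.
(* The m + 1 pairs have positive weight, so a total of n is impossible when m is at least n. *)
rewrite big_pred0 // => p; apply/negP => /andP[/forallP p0 /eqP sp].
have : (\sum_(i < m.+1) 1 <= n)%N by rewrite -sp; apply: leq_sum => i _; exact: p0.
by rewrite sum_nat_const card_ord muln1; lia.
Qed.

(** Each word of length n evaluates into [J n], which is zero since n is at least [N]. *)
Lemma coef_hlog_tmul0 (X Y : B) n : J 1%N X -> J 1%N Y -> (M.+1 <= n)%N ->
  (hlog M.+1 (hexp M.+1 (tmul X) * hexp M.+1 (tmul Y) - 1))`_n = 0.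
Proof.
move=> JX JY nM.
have nk : n%:R != 0 :> k by case: n nM => // n _; exact: natr_neq0.
apply: (scalerI nk); rewrite scaler_nat coef_hlog_tmul // scaler0.
rewrite big1 // => m _; rewrite big1 // => p /andP[_ /eqP sp].
rewrite (nf_nil JF (_ : J N (nbr _ _))) ?scaler0 //.
apply: (@nfW _ _ _ _ JF _ n); first by lia.
rewrite -[n in J n]sp -(size_bword (fun i => (val (p i).1, val (p i).2))) -(size_map (fun b
  : bool => if b then X else Y)).
by apply: (nf_nbr JF) => z /mapP [b _ ->]; case: b.
Qed.

(* Dynkin's formula: both sides of [exp (ad D) = exp (ad (t X)) exp (ad (t Y))],
   for [D] the logarithm of [exp (t X) exp (t Y)], have the same logarithm,
   which is evaluated at the derivation [- t d/dt]. *)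
Lemma hlog_bcht (X Y : B) : J 1%N X -> J 1%N Y ->
  hlog M.+1 (hexp M.+1 X * hexp M.+1 Y - 1) = \sum_(n < M.+1) bcht comm X Y n.
Proof.
move=> JX JY; set D := hlog M.+1 (hexp M.+1 (tmul X) * hexp M.+1 (tmul Y) - 1).
have -> : hlog M.+1 (hexp M.+1 X * hexp M.+1 Y - 1) = ev1 D.
  rewrite /D rmorph_hlog rmorphB rmorph1 rmorphM /= !rmorph_hexp.
  by rewrite /= !ev1_tmul.
have D0 : D`_0 = 0.
  rewrite -[LHS]/(ev0 D) /D rmorph_hlog rmorphB rmorph1 rmorphM /= !rmorph_hexp.
  rewrite /= !ev0_tmul hexp0 mulr1 subrr /hlog big1 // => i _.
  by rewrite expr0n scaler0.
rewrite /ev1 (@horner_coef_wide _ M.+1); last first.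
  by apply/leq_sizeP => n nM; apply: coef_hlog_tmul0.
apply: eq_bigr => n _; rewrite expr1n mulr1.
have [n0|n0] := posnP n; last by rewrite coef_dynkin // n0 ltn_ord.
by rewrite n0 D0 /bcht big_ord0.
Qed.

End Dynkin.

(** * The group law on a nilpotent Lie algebra *)

(** Stated for bare functions: no ring of endomorphisms is involved, hence no choice of a nonzero
    vector. *)
Definition fexp (k : fieldType) (V : lmodType k) M (f : V -> V) (v : V) : V :=
  \sum_(i < M) (i`!%:R : k)^-1 *: iter i f v.

Definition bchN (k : fieldType) (L : lmodType k) (br : L -> L -> L) M x y : L :=
  \sum_(n < M) bcht br x y n.

Lemma nbr_map (k : fieldType) (L1 L2 : lmodType k) (br1 : L1 -> L1 -> L1) (br2 : L2 -> L2 -> L2)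
    (f : L1 -> L2) (w : seq L1) :
  f 0 = 0 -> (forall x y, f (br1 x y) = br2 (f x) (f y)) ->
  f (nbr br1 w) = nbr br2 (map f w).
Proof. by move=> f0 fbr; elim: w => [|x [|y w] IH] //; rewrite [LHS]fbr IH. Qed.

Section BchMap.
Context (k : fieldType) (L1 L2 : lmodType k).
Context (br1 : L1 -> L1 -> L1) (br2 : L2 -> L2 -> L2) (f : {linear L1 -> L2}).
Hypothesis fbr : forall x y, f (br1 x y) = br2 (f x) (f y).

Lemma bcht_map x y n : f (bcht br1 x y n) = bcht br2 (f x) (f y) n.
Proof.
rewrite !bcht_bword linear_sum; apply: eq_bigr => m _.
rewrite linear_sum; apply: eq_bigr => p _; rewrite linearZ /=; congr (_ *: _).
rewrite (nbr_map (br2 := br2)) ?linear0 // -map_comp; congr nbr.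
by apply: eq_map => -[].
Qed.

Lemma bchN_map M x y : f (bchN br1 M x y) = bchN br2 M (f x) (f y).
Proof. by rewrite linear_sum; apply: eq_bigr => n _; apply: bcht_map. Qed.

End BchMap.

Record lie_bracket (k : fieldType) (L : lmodType k) (br : L -> L -> L) : Prop :=
  LieBracket {
  lb_linl : forall y, linear (fun x => br x y);
  lb_linr : forall x, linear (br x);
  lb_anti : forall x y, br x y = - br y x;
  lb_jac : forall x y z, br x (br y z) = br (br x y) z + br y (br x z)
}.

Record vfilt (k : fieldType) (V : lmodType k) (N : nat) (F : nat -> V -> Prop) : Prop :=
  VFilt {
  vf_lin : forall n a x y, F n x -> F n y -> F n (a *: x + y);
  vf_zero : forall n, F n 0;
  vf_anti : forall n x, F n.+1 x -> F n x;
  vf_top : forall x, F 0%N x;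
  vf_nil : forall x, F N x -> x = 0
}.

Section EndoFilt.
Context (k : fieldType) (V : lmodType k) (v0 : V) (nz : v0 != 0).
Context (N : nat) (F : nat -> V -> Prop) (VF : vfilt N F).

Definition efilt n (u : endo nz) := forall m v, F m v -> F (m + n)%N (u v).

Lemma efiltP : nfilt N efilt.
Proof.
split=> [n a x y Jx Jy m v Fv|n m v _|m v|m n x y Jx Jy i v Fv|n x Jx m v Fv|x Jx].
- by apply: (vf_lin VF); [apply: Jx|apply: Jy].
- exact: (vf_zero VF).
- by rewrite addn0.
- by rewrite [(m + n)%N]addnC addnA; apply: Jx; apply: Jy.
- by apply: (vf_anti VF); rewrite -addnS; apply: Jx.
- by apply: endoP => v; apply: (vf_nil VF); apply: (Jx 0%N); apply: (vf_top VF).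
Qed.

Lemma endo_fexp M (u : endo nz) v : hexp M u v = fexp M u v.
Proof.
rewrite endo_sumE; apply: eq_bigr => i _.
by rewrite endo_scaleE endo_expE.
Qed.

End EndoFilt.

(** * The Baker-Campbell-Hausdorff identity in nilpotent representations *)

Section Representation.
Context (k : fieldType) (k0 : has_pchar0 k) (L V : lmodType k).
Context (br : L -> L -> L) (rho : L -> V -> V) (v0 : V) (nz : v0 != 0).
Context (N M : nat) (F : nat -> V -> Prop) (VF : vfilt N F).
Hypothesis rho_linl : forall v, linear (fun x => rho x v).
Hypothesis rho_linr : forall x, linear (rho x).
Hypothesis rho_br : forall x y v,
  rho (br x y) v = rho x (rho y v) - rho y (rho x v).
Hypothesis rhoF : forall x n v, F n v -> F n.+1 (rho x v).
Hypothesis NM : (N.*2 <= M.+1)%N.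

Definition rho_endo x : endo nz := Endo nz (rho_linr x).

Fact rho_endo_lin : linear rho_endo.
Proof. by move=> a x y; apply: endoP => v; apply: rho_linl. Qed.
HB.instance Definition _ :=
  GRing.isLinear.Build k L (endo nz) *:%R rho_endo rho_endo_lin.

(** Endomorphisms are filtered by how far they raise [F], so each [rho x] lies in step 1. A
    representation carries BCH to BCH for commutators, which is log (exp (rho x) exp (rho y)) by
    Dynkin's formula. *)
Lemma rep_bch x y v :
  fexp M.+1 (rho x) (fexp M.+1 (rho y) v) = fexp M.+1 (rho (bchN br M.+1 x y)) v.
Proof.
have J1 z : efilt F 1 (rho_endo z) by move=> n w; rewrite addn1; apply: rhoF.
have JF := efiltP nz VF.
rewrite -[RHS](endo_fexp (nz := nz) _ (rho_endo _)).
rewrite (bchN_map (f := rho_endo) (br2 := comm)); last first.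
  by move=> z t; apply: endoP => w; apply: rho_br.
rewrite /bchN -(hlog_bcht k0 JF NM) // hexp_hlog //; last first.
  apply: (nf_expr0 JF); last by lia.
  by apply: (nf_mul1 JF); apply: (nf_hexp JF).
by rewrite addrC subrK endo_mulE !endo_fexp.
Qed.

End Representation.

(** * Group axioms for the truncated BCH product *)

Section NilpotentGroup.
Context (k : fieldType) (k0 : has_pchar0 k) (L : lmodType k) (br : L -> L -> L).
Context (LB : lie_bracket br) (N M : nat) (F : nat -> L -> Prop).
Context (VF : vfilt N F) (brF : forall x n y, F n y -> F n.+1 (br x y)).
Hypothesis NM : (N.+1.*2 <= M.+1)%N.

HB.instance Definition _ x := GRing.isLinear.Build k L L *:%R (br x) (lb_linr LB x).

Let brDl x y z : br (x + y) z = br x z + br y z.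
Proof. by have := lb_linl LB z 1 x y; rewrite /= !scale1r. Qed.
Let br0l y : br 0 y = 0.
Proof. by apply: (addIr (br 0 y)); rewrite -brDl !add0r. Qed.
Let brZl a x y : br (a *: x) y = a *: br x y.
Proof. by have := lb_linl LB y a x 0; rewrite /= br0l !addr0. Qed.
Let br_suml I (r : seq I) (P : pred I) (G : I -> L) y :
  br (\sum_(i <- r | P i) G i) y = \sum_(i <- r | P i) br (G i) y.
Proof.
by elim/big_rec2: _ => [|i a b _ <-]; rewrite ?br0l ?brDl.
Qed.

Fact unit_neq0 : (0, 1) != 0 :> L * k^o.
Proof. by rewrite xpair_eqE eqxx oner_neq0. Qed.
Local Notation B := (endo unit_neq0).

(* [(m, c)] stands for [m - c t d/dt], so that the coefficient of [t^n] in
   [ad (t^n x)] is [hat n x]. *)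
Fact hat_lin n x : linear (fun q : L * k^o => (br x q.1 + q.2 *: (x *+ n), 0 : k^o)).
Proof.
move=> a q r; congr (_, _); rewrite /= ?scaler0 ?addr0 //.
by rewrite linearP scalerDl scalerDr addrACA scalerA.
Qed.
Definition hat n x : B := Endo unit_neq0 (hat_lin n x).

(** The filtration [F] shifted by one, with the direction of E present only in step 0; its length is
    therefore N + 1. *)
Definition hatF n (q : L * k^o) : Prop :=
  if n is n'.+1 then F n' q.1 /\ q.2 = 0 else True.

Lemma hatFP : vfilt N.+1 hatF.
Proof.
split=> [[|n] a x y|[|n]|[|n] x|x|[m c]] //=.
- move=> [x1 x2] [y1 y2]; split; first exact: (vf_lin VF).
  by rewrite x2 y2 scaler0 addr0.
- by split; [apply: (vf_zero VF)|].
- by case=> [/(vf_anti VF)].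
- by case=> /(vf_nil VF) -> ->.
Qed.

Let JF := efiltP unit_neq0 hatFP.
Let TF := tfiltP JF.

Lemma efilt_hat n x : efilt hatF 1 (hat n x).
Proof.
move=> [|m] q; rewrite addn1 /=; first by split=> //; apply: (vf_top VF).
by case=> Fq ->; split=> //; rewrite scale0r addr0; apply: brF.
Qed.

(* [u] is [ad (\sum_n l_n t^n)], and [z] is the value of this series at [t = 1]. *)
Definition lifts (u : tpoly B) (z : L) := exists (l : nat -> L) (K : nat),
  [/\ l 0%N = 0, forall n, (K <= n)%N -> l n = 0,
      forall n, (K <= n)%N -> z = \sum_(i < n) l i & forall n, u`_n = hat n (l n)].

Lemma hat_linear n a x y : hat n (a *: x + y) = a *: hat n x + hat n y.
Proof.
apply: endoP => q; congr (_, _); rewrite /= ?scaler0 ?addr0 // brDl brZl.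
by rewrite mulrnDl !scalerDr addrACA; congr (_ + _ + _); rewrite !scalerA -!scaler_nat
  !scalerA; congr (_ *: _); ring.
Qed.

Lemma hat_comm m n x y : comm (hat m x) (hat n y) = hat (m + n) (br x y).
Proof.
apply: endoP => q; congr (_, _); rewrite /= ?subr0 // !scale0r !addr0 !linearD /=.
rewrite !linearZ /= !raddfMn /= (lb_jac LB x y) (lb_anti LB y x).
rewrite addrACA addrK opprK -mulrnDr.
by rewrite addnC.
Qed.

Lemma hat0 n : hat n 0 = 0.
Proof. by apply: endoP => q; congr (_, _); rewrite /= br0l mul0rn scaler0 addr0. Qed.

(** Faithfulness: evaluated at - E, the coefficient of t^n returns n l_n, which determines l_n for n
    > 0, while l_0 = 0 by definition. *)
Lemma lifts_inj u z z' : lifts u z -> lifts u z' -> z = z'.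
Proof.
move=> [l [K [l0 lK lz lu]]] [l' [K' [l'0 l'K l'z l'u]]].
rewrite (lz (maxn K K')) ?leq_maxl // (l'z (maxn K K')) ?leq_maxr //.
apply: eq_bigr => -[[|n] nK] _ /=; first by rewrite l0 l'0.
have := congr1 (fun v : B => (v (0, 1)).1) (etrans (esym (lu n.+1)) (l'u n.+1)).
rewrite /= !linear0 !add0r !scale1r => /eqP; rewrite -subr_eq0 -mulrnBl -scaler_nat.
by rewrite scaler_eq0 (negbTE (natr_neq0 k0 n)) subr_eq0 => /eqP.
Qed.

Lemma lifts_lin a u v y z : lifts u y -> lifts v z -> lifts (a *: u + v) (a *: y + z).
Proof.
move=> [l [K [l0 lK lz lu]]] [l' [K' [l'0 l'K l'z l'u]]].
exists (fun n => a *: l n + l' n), (maxn K K'); split.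
- by rewrite l0 l'0 scaler0 addr0.
- by move=> n; rewrite geq_max => /andP[? ?]; rewrite lK ?l'K ?scaler0 ?addr0.
- move=> n; rewrite geq_max => /andP[Kn K'n].
  by rewrite (lz n) // (l'z n) // scaler_sumr -big_split.
- by move=> n; rewrite coefD coef_tscale lu l'u hat_linear.
Qed.

Lemma lifts0 : lifts 0 0.
Proof.
exists (fun _ => 0), 0%N; split=> // [n _|n]; first by rewrite big1.
by rewrite coef0 hat0.
Qed.

Lemma liftsN u z : lifts u z -> lifts (- u) (- z).
Proof. by move=> /(lifts_lin (-1)) /(_ lifts0); rewrite !addr0 !scaleN1r. Qed.

Lemma lifts_sum I (r : seq I) (P : pred I) (U : I -> tpoly B) (Z : I -> L) :
  (forall i, P i -> lifts (U i) (Z i)) ->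
  lifts (\sum_(i <- r | P i) U i) (\sum_(i <- r | P i) Z i).
Proof.
move=> UZ; elim/big_rec2: _ => [|i z u Pi uz]; first exact: lifts0.
by have := lifts_lin 1 (UZ i Pi) uz; rewrite !scale1r.
Qed.

Lemma lifts_comm u v y z : lifts u y -> lifts v z -> lifts (comm u v) (br y z).
Proof.
move=> [l [K [l0 lK lz lu]]] [l' [K' [l'0 l'K l'z l'u]]].
have br_vanish n i j : (K + K' <= n)%N -> (n <= i + j)%N -> br (l i) (l' j) = 0.
  move=> Kn nij; case: (leqP K i) => Ki; first by rewrite lK // br0l.
  by rewrite l'K ?linear0 //; lia.
(* The Cauchy product of the two series; it vanishes from degree K + K' on because one of the two
   indices is then beyond its bound. *)
exists (fun n => \sum_(i < n.+1) br (l i) (l' (n - i)%N)), (K + K')%N; split.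
- by rewrite big_ord_recl big_ord0 l0 br0l addr0.
- move=> n Kn; rewrite big1 // => i _; apply: (br_vanish n) => //.
  by have := ltn_ord i; lia.
- move=> n Kn; rewrite (triangle_sum (G := fun i j => br (l i) (l' j))); last first.
    by move=> i j; apply: br_vanish.
  rewrite (lz n) 1?(l'z n); try lia.
  by rewrite br_suml; apply: eq_bigr => i _; rewrite linear_sum.
- move=> n; rewrite coefB coefM coefMr -sumrB.
  rewrite (eq_bigr (fun i : 'I_n.+1 => hat n (br (l i) (l' (n - i)%N)))); last first.
    move=> i _; rewrite !lu !l'u -[LHS]/(comm _ _) hat_comm subnKC //.
    by rewrite -ltnS.
  by elim/big_rec2: _ => [|i a b _ ->]; rewrite ?hat0 // -[X in X + _]scale1r -hat_linear
    scale1r.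
Qed.

Lemma lifts_tmul x : lifts (tmul (hat 1 x)) x.
Proof.
exists (fun n => if n == 1%N then x else 0), 2; split=> //.
- by case=> [|[|n]].
- case=> [|[|n]] // _; rewrite !big_ord_recl big1 ?addr0 ?add0r // => i _.
- by move=> n; rewrite coef_tmul; case: eqP => [->|_] //; rewrite hat0.
Qed.

Lemma lifts_bch u v y z : lifts u y -> lifts v z ->
  lifts (bchN comm M.+1 u v) (bchN br M.+1 y z).
Proof.
move=> uy vz; apply: lifts_sum => n _; rewrite !bcht_bword.
apply: lifts_sum => m _; apply: lifts_sum => p _.
rewrite -[X in lifts X]addr0 -[X in lifts _ X]addr0; apply: lifts_lin lifts0.
elim: (bword _) => [|b [|b' w] IH]; first exact: lifts0.
  by case: b.
by apply: (lifts_comm (u := if b then u else v)) => //; case: b.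
Qed.

Let J1 x : tfilt (efilt hatF) 1 (tmul (hat 1 x)).
Proof. by apply: (tfilt_tmul JF); apply: efilt_hat. Qed.

Let bchS (u v : tpoly B) : tfilt (efilt hatF) 1 u -> tfilt (efilt hatF) 1 v ->
  bchN comm M.+1 u v = hlog M.+1 (hexp M.+1 u * hexp M.+1 v - 1).
Proof. by move=> ? ?; rewrite /bchN -(hlog_bcht k0 TF NM). Qed.

(** Both sides lift to the logarithm of the same triple product of exponentials in an associative
    algebra, and lifts are determined by [lifts_inj]. *)
Lemma bchNA x y z :
  bchN br M.+1 (bchN br M.+1 x y) z = bchN br M.+1 x (bchN br M.+1 y z).
Proof.
have l := lifts_tmul.
have := lifts_bch (lifts_bch (l x) (l y)) (l z).
have := lifts_bch (l x) (lifts_bch (l y) (l z)).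
rewrite (bchS (J1 x) (J1 y)) (bchS (J1 y) (J1 z)).
have J2 (u v : tpoly B) : tfilt (efilt hatF) 1 u -> tfilt (efilt hatF) 1 v ->
    tfilt (efilt hatF) 1 (hexp M.+1 u * hexp M.+1 v - 1).
  by move=> Ju Jv; apply: (nf_mul1 TF); apply: (nf_hexp TF).
have E2 (u v : tpoly B) (Ju : tfilt (efilt hatF) 1 u) (Jv : tfilt (efilt hatF) 1 v) :
    hexp M.+1 (hlog M.+1 (hexp M.+1 u * hexp M.+1 v - 1)) = hexp M.+1 u * hexp M.+1 v.
  rewrite hexp_hlog //; first by rewrite addrC subrK.
  by apply: (nf_expr0 TF (J2 _ _ Ju Jv)); lia.
rewrite !bchS ?E2 ?mulrA => //; try exact: J1; try by apply: (nf_hlog TF); apply: J2.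
by move=> h1 h2; apply: lifts_inj h2 h1.
Qed.

Lemma bchN0l x : bchN br M.+1 0 x = x.
Proof.
have := lifts_bch lifts0 (lifts_tmul x).
rewrite bchS //; last by move=> i; rewrite coef0; apply: (nf_zero JF).
rewrite hexp0 mul1r hlog_hexp //; last by apply: (nf_expr0 TF (J1 x)); lia.
by move/lifts_inj/(_ (lifts_tmul x)).
Qed.

Lemma bchNNl x : bchN br M.+1 (- x) x = 0.
Proof.
have := lifts_bch (liftsN (lifts_tmul x)) (lifts_tmul x).
have JN : tfilt (efilt hatF) 1 (- tmul (hat 1 x)) by apply: (nfN TF).
rewrite bchS //.
have := hexpN k0 (nf_expr0 TF JN (_ : (N.+1 <= M.+1)%N)); rewrite opprK => -> //; last by lia.
rewrite subrr /hlog big1 => [|i _]; last by rewrite expr0n scaler0.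
by move/lifts_inj/(_ lifts0).
Qed.

End NilpotentGroup.

(** * The gauge action on a nilpotent curved Lie algebra *)

Lemma brNl (k : fieldType) (g : curvedLie k) (i j m : int) (e : i + j = m)
    (x : g i) (y : g j) : cl_br e (- x) y = - cl_br e x y.
Proof. by rewrite -scaleN1r brZl scaleN1r. Qed.

Section LowerCentralSeries.
Context (k : fieldType) (g : curvedLie k).

Lemma lcs0 n i : lcs n (0 : g i).
Proof.
elim: n i => [|n IH] i; first exact: lcs_top.
have <- : cl_br (add0r i) (0 : g 0) (0 : g i) = 0 by rewrite linear0.
exact: lcs_br.
Qed.

Lemma lcsD n i (x y : g i) : lcs n x -> lcs n y -> lcs n (x + y).
Proof. by move=> lx ly; rewrite -[x]scale1r; apply: lcs_lin. Qed.

Lemma lcsZ n i a (x : g i) : lcs n x -> lcs n (a *: x).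
Proof. by move=> lx; rewrite -[_ *: _]addr0; apply: lcs_lin => //; apply: lcs0. Qed.

Lemma lcs_sum n i I (r : seq I) (P : pred I) (U : I -> g i) :
  (forall j, P j -> lcs n (U j)) -> lcs n (\sum_(j <- r | P j) U j).
Proof. by move=> lU; elim/big_ind: _ => //; [apply: lcs0|apply: lcsD]. Qed.

Lemma lcsS n i (x : g i) : lcs n.+1 x -> lcs n x.
Proof.
move=> lx; have [m nm] : exists m, m = n.+1 by exists n.+1.
rewrite -nm in lx; elim: lx n nm => {m i x} [i x|m i j l e x y ly IH|m i a x y _ IHx _ IHy]
  n //.
- case=> mn; case: n mn => [|n] mn; first exact: lcs_top.
  by apply: lcs_br; apply: IH.
- by move=> mn; apply: lcs_lin; [apply: IHx|apply: IHy].
Qed.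

Lemma lcsW m n i (x : g i) : (m <= n)%N -> lcs n x -> lcs m x.
Proof. by move=> /subnK <-; elim: (n - m)%N => // d IH /lcsS. Qed.

Lemma lcs_ad0 n i (y : g 0) (x : g i) : lcs n x -> lcs n.+1 (ad0 y x).
Proof. exact: lcs_br. Qed.

Lemma lcs_nested (w : seq (g 0)) : lcs (size w).-1 (nested_br w).
Proof.
elim: w => [|x [|y w] IH]; [exact: lcs_top|exact: lcs_top|].
exact: lcs_ad0 IH.
Qed.

End LowerCentralSeries.

Lemma lcs_hom (k : fieldType) (g h : curvedLie k) (f : curvedHom g h) n i (x : g i) :
  lcs n x -> lcs n (f i x).
Proof.
elim=> {n i x} [i x|n i j m e x y _ IH|n i a x y _ IHx _ IHy].
- exact: lcs_top.
- by rewrite ch_br; apply: lcs_br.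
- by rewrite linearP; apply: lcs_lin.
Qed.

Section Degree0.
Context (k : fieldType) (g : curvedLie k).

HB.instance Definition _ i (y : g 0) := GRing.Linear.copy (@ad0 k g i y) (cl_br (add0r i) y).

Lemma nested_nbr (w : seq (g 0)) : nested_br w = nbr (@ad0 k g 0) w.
Proof. by elim: w => [|x [|y w] IH] //=; rewrite -IH. Qed.

Lemma bch_termE (x y : g 0) n : bch_term x y n = bcht (@ad0 k g 0) x y n.
Proof.
apply: eq_bigr => m _; apply: eq_bigr => p _; congr (_ *: _).
Qed.

Lemma ad0_linl i (x : g i) : linear (fun y : g 0 => ad0 y x).
Proof. by move=> a y z; rewrite /ad0 brDl brZl. Qed.

Lemma ad0_jac i (y z : g 0) (x : g i) :
  ad0 y (ad0 z x) = ad0 (ad0 y z) x + ad0 z (ad0 y x).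
Proof.
rewrite /ad0 (cl_jacobi (add0r 0) (add0r i) (add0r i) _ (add0r i) (add0r i)).
by rewrite mul0r expr0z scale1r.
Qed.

Lemma ad0_anti (y z : g 0) : ad0 y z = - ad0 z y.
Proof. by rewrite /ad0 (cl_anti _ (add0r 0)) mul0r expr0z scale1r. Qed.

Lemma ad0_lie : lie_bracket (@ad0 k g 0).
Proof.
split; [exact: ad0_linl|by move=> x; exact: linearP|exact: ad0_anti|].
exact: ad0_jac.
Qed.

Lemma lcs_vfilt c : (forall i (x : g i), lcs c x -> x = 0) -> forall i,
  vfilt c (fun n (x : g i) => lcs n x).
Proof.
move=> gc i; split=> [n a x y|n|n x|x|x].
- exact: lcs_lin.
- exact: lcs0.
- exact: lcsS.
- exact: lcs_top.
- exact: gc.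
Qed.

(* The action of [g 0] on [g 1 + k delta] with [[y, delta] = - d y]; the gauge
   action is the exponential of this action on the affine hyperplane through
   [delta]. *)
Definition grho (y : g 0) (q : g 1 * k^o) : g 1 * k^o :=
  (ad0 y q.1 - q.2 *: cl_d (add0r 1) y, 0).

Lemma grho_linl q : linear (grho^~ q).
Proof.
move=> a y z; congr (_, _); rewrite /= ?scaler0 ?addr0 // ad0_linl linearP /=.
by rewrite scalerDr opprD addrACA scalerBr !scalerA mulrC.
Qed.

Lemma grho_linr y : linear (grho y).
Proof.
move=> a q r; congr (_, _); rewrite /= ?scaler0 ?addr0 // linearP /=.
by rewrite scalerDl opprD addrACA scalerBr scalerA.
Qed.

Lemma d_ad0 (y z : g 0) :
  cl_d (add0r 1) (ad0 y z) = ad0 y (cl_d (add0r 1) z) - ad0 z (cl_d (add0r 1) y).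
Proof.
rewrite /ad0 (cl_leibniz _ _ (add0r 1) (add0r 1) (addr0 1) (add0r 1)).
by rewrite expr0z scale1r addrC (cl_anti (addr0 1) (add0r 1)) mulr0 expr0z scale1r.
Qed.

(** On [g 1] this is the Jacobi identity; on delta it is the Leibniz rule for d. *)
Lemma grho_br y z q : grho (ad0 y z) q = grho y (grho z q) - grho z (grho y q).
Proof.
congr (_, _); rewrite /= ?subr0 // !scale0r !subr0 !linearB /= !linearZ /=.
rewrite (ad0_jac y z) d_ad0 addrACA addrK -scalerDr.
by rewrite opprD !opprK.
Qed.

Definition grhoF n (q : g 1 * k^o) : Prop :=
  if n is n'.+1 then lcs n' q.1 /\ q.2 = 0 else True.

Lemma grhoFP c : (forall i (x : g i), lcs c x -> x = 0) -> vfilt c.+1 grhoF.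
Proof.
move=> gc; split=> [[|n] a x y|[|n]|[|n] x|x|[m l]] //=.
- move=> [x1 x2] [y1 y2]; split; first exact: lcs_lin.
  by rewrite x2 y2 scaler0 addr0.
- by split; [apply: lcs0|].
- by case=> [/lcsS].
- by case=> /gc -> ->.
Qed.

Lemma grho_grhoF y n q : grhoF n q -> grhoF n.+1 (grho y q).
Proof.
case: n => [|n] /=; first by split=> //; apply: lcs_top.
by case=> lq ->; split=> //; rewrite scale0r subr0; apply: lcs_ad0.
Qed.

Definition gauge_term (y : g 0) (xi : g 1) (r : nat) : g 1 :=
  (r.+1`!%:R : k)^-1 *: iter r (ad0 y) (ad0 y xi - cl_d (add0r 1) y).

Definition gaugeN M (y : g 0) (xi : g 1) : g 1 :=
  xi + \sum_(r < M) gauge_term y xi r.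

Lemma iter_grho y xi r :
  iter r.+1 (grho y) (xi, 1) = (iter r (ad0 y) (ad0 y xi - cl_d (add0r 1) y), 0).
Proof.
elim: r => [|r IH]; first by rewrite /= /grho /= scale1r.
by rewrite iterS IH /grho /= scale0r subr0.
Qed.

(** The term of index 0 of the exponential is the point itself, so M + 1 terms of the exponential
    match M terms of the gauge series. *)
Lemma fexp_grho M y xi : fexp M.+1 (grho y) (xi, 1) = (gaugeN M y xi, 1).
Proof.
rewrite /fexp big_ord_recl fact0 invr1 scale1r [LHS]surjective_pairing.
rewrite !raddfD !raddf_sum; congr (_, _); last first.
  by rewrite big1 ?addr0 // => r _; rewrite iter_grho /= scaler0.
by congr (_ + _); apply: eq_bigr => r _; rewrite iter_grho.
Qed.

Lemma gaugeN_bch (k0 : has_pchar0 k) c M (y z : g 0) (xi : g 1) :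
  (forall i (x : g i), lcs c x -> x = 0) -> (c.+1.*2 <= M.+1)%N ->
  gaugeN M y (gaugeN M z xi) = gaugeN M (bchN (@ad0 k g 0) M.+1 y z) xi.
Proof.
move=> gc cM.
have /= := rep_bch k0 (unit_neq0 (g 1)) (grhoFP gc) grho_linl grho_linr grho_br grho_grhoF
  cM y z (xi, 1).
by rewrite !fexp_grho => -[].
Qed.

End Degree0.

(** * Exponentials of derivations of a bilinear map *)

Section ExpBilinear.
Context (k : fieldType) (k0 : has_pchar0 k) (U V W : lmodType k).
Context (S : U -> V -> W) (a : U -> U) (b : V -> V) (c : W -> W).
Hypothesis S_linl : forall v, linear (S^~ v).
Hypothesis S_linr : forall u, linear (S u).
Hypothesis c_lin : linear c.
Hypothesis cS : forall u v, c (S u v) = S (a u) v + S u (b v).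

Let Sl v u := S u v.
HB.instance Definition _ v := GRing.isLinear.Build k U W *:%R (Sl v) (S_linl v).
HB.instance Definition _ u := GRing.isLinear.Build k V W *:%R (S u) (S_linr u).
HB.instance Definition _ := GRing.isLinear.Build k W W *:%R c c_lin.

Lemma iter_leibniz n u v :
  iter n c (S u v) = \sum_(i < n.+1) S (iter i a u) (iter (n - i) b v) *+ 'C(n, i).
Proof.
elim: n u v => [|n IH] u v; first by rewrite big_ord_recl big_ord0 addr0.
rewrite iterSr cS.
have cD x y : iter n c (x + y) = iter n c x + iter n c y.
  by elim: n {IH} => //= n ->; rewrite linearD.
rewrite cD !IH [RHS]big_ord_recl /= bin0 mulr1n.
rewrite [X in _ = _ + X](eq_bigr (fun i : 'I_n.+1 =>
    S (iter i.+1 a u) (iter (n - i) b v) *+ 'C(n, i.+1)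
    + S (iter i.+1 a u) (iter (n - i) b v) *+ 'C(n, i))); last first.
  by move=> i _; rewrite /bump add1n subSS binS mulrnDr.
rewrite big_split /= addrA [LHS]addrC; congr (_ + _); last first.
  by apply: eq_bigr => i _; rewrite -iterS iterSr.
rewrite big_ord_recl /= bin0 mulr1n subn0 -iterSr; congr (_ + _).
rewrite [RHS]big_ord_recr /= bin_small // mulr0n addr0.
apply: eq_bigr => i _; rewrite /bump add1n -iterSr.
by rewrite -subSn // subSS.
Qed.

(** The exponential of a derivation is multiplicative: iterate the Leibniz rule and regroup the
    binomial sum by [divided_sum]. *)
Lemma fexp_bilinear M u v :
  (forall i j, (M <= i + j)%N -> S (iter i a u) (iter j b v) = 0) ->
  fexp M c (S u v) = S (fexp M a u) (fexp M b v).
Proof.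
move=> S0; rewrite /fexp.
rewrite (eq_bigr (fun n : 'I_M => (n`!%:R : k)^-1 *: \sum_(i < n.+1)
   S (iter i a u) (iter (n - i) b v) *+ 'C(n, i))); last first.
  by move=> n _; rewrite iter_leibniz.
rewrite (divided_sum k0 (F := fun i j => S (iter i a u) (iter j b v))) //.
rewrite -[RHS]/(Sl _ _) linear_sum; apply: eq_bigr => i _.
rewrite linearZ /= /Sl linear_sum scaler_sumr; apply: eq_bigr => j _.
by rewrite linearZ /= scalerA.
Qed.
End ExpBilinear.

(** * Gauge invariance of the Maurer-Cartan equation and stabilizers, nilpotent case *)

Section GaugeNilpotent.
Context (k : fieldType) (k0 : has_pchar0 k) (g : curvedLie k).
Context (c M : nat) (gc : forall i (x : g i), lcs c x -> x = 0).
Hypothesis cM : (c.+1.*2 <= M.+1)%N.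

(* The bracket [g 1 + k delta] x [g 1 + k delta] -> [g 2], with
   [[delta, x] = d x] and [[delta, delta] = 2 Om]. *)
Definition dbr (q r : g 1 * k^o) : g 2%:R :=
  cl_br (erefl : 1 + 1 = 2%:R :> int) q.1 r.1
  + (q.2 : k) *: cl_d (erefl : 1 + 1 = 2%:R :> int) r.1
  + (r.2 : k) *: cl_d (erefl : 1 + 1 = 2%:R :> int) q.1
  + (2%:R * q.2 * r.2 : k) *: cl_Om g.

(** The curvature at xi is half of [xi + delta, xi + delta], so the Maurer-Cartan equation becomes a
    homogeneous quadratic equation. *)
Lemma curv_dbr xi : curv xi = (2%:R : k)^-1 *: dbr (xi, 1) (xi, 1).
Proof.
rewrite /curv /dbr /= !scale1r !mulr1 !scalerDr !scalerA mulVf ?natr_neq0 // scale1r.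
rewrite [RHS]addrC -addrA; congr (_ + _); rewrite -addrA addrC; congr (_ + _).
by rewrite -scalerDr; apply: (Defs.half_double k0); rewrite addrK.
Qed.

Lemma br11C (x y : g 1) : cl_br (erefl : 1 + 1 = 2%:R :> int) x y =
  cl_br (erefl : 1 + 1 = 2%:R :> int) y x.
Proof. by rewrite {1}(cl_anti erefl erefl) mulr1 expr1z scaleN1r opprK. Qed.

Lemma dbr_linl r : linear (dbr^~ r).
Proof.
move=> a x y; rewrite /dbr !scalerDr [RHS]addrACA; congr (_ + _); last first.
  by rewrite scalerA -scalerDl; congr (_ *: _); rewrite /= -[a *: x.2]/((a : k) * x.2); ring.
rewrite [RHS]addrACA; congr (_ + _); last first.
  by rewrite linearP /= scalerDr !scalerA mulrC.
rewrite [RHS]addrACA brDl brZl; congr (_ + _).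
by rewrite /= scalerDl scalerA.
Qed.

Lemma dbrC q r : dbr q r = dbr r q.
Proof.
rewrite /dbr br11C; congr (_ + _); last by rewrite mulrAC.
by rewrite addrAC.
Qed.

Lemma dbr_linr q : linear (dbr q).
Proof. by move=> a x y; rewrite ![dbr q _]dbrC; apply: dbr_linl. Qed.

(** [ad0 y] is a derivation of the extended bracket. The identity d (d y) = [Om, y] accounts for the
    component [delta, delta] = 2 Om. *)
Lemma ad0_dbr y q r : ad0 y (dbr q r) = dbr (grho y q) r + dbr q (grho y r).
Proof.
have leib z : cl_d (erefl : 1 + 1 = 2%:R :> int) (ad0 y z) =
    cl_br (erefl : 1 + 1 = 2%:R :> int) (cl_d (add0r 1) y) z
    + ad0 y (cl_d (erefl : 1 + 1 = 2%:R :> int) z).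
  by rewrite /ad0 (cl_leibniz _ _ (add0r 1) erefl erefl (add0r _)) expr0z scale1r.
have dd : cl_d (erefl : 1 + 1 = 2%:R :> int) (cl_d (add0r 1) y) = - ad0 y (cl_Om g).
  rewrite (cl_dd _ _ (addr0 _)) (cl_anti _ (add0r _)) mulr0 expr0z scale1r //.
rewrite /dbr /grho /= !scale0r !addr0 !mulr0 mul0r !scale0r !addr0 !linearD /= !linearZ /=
  !linearN /=.
have jac : ad0 y (cl_br (erefl : 1 + 1 = 2%:R :> int) q.1 r.1) =
    cl_br (erefl : 1 + 1 = 2%:R :> int) (ad0 y q.1) r.1
    + cl_br (erefl : 1 + 1 = 2%:R :> int) q.1 (ad0 y r.1).
  rewrite /ad0 (cl_jacobi (add0r 1) erefl (add0r 1) _ erefl erefl).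
  by rewrite mul0r expr0z scale1r.
rewrite !leib dd brDl brNl brZl jac (br11C q.1 (cl_d _ y)) !scalerN !opprK !scalerDr !scalerA.
rewrite (_ : 2%:R * q.2 * r.2 = q.2 * r.2 + r.2 * q.2 :> k); last by ring.
rewrite scalerDl !addrA.
rewrite [RHS](ACl (((1*6)*9)*4*5*10*(2*8)*(3*7))%AC) /=.
by rewrite addNr subrr !addr0.
Qed.

Lemma lcs_iter i n m (y : g 0) (x : g i) : lcs m x -> lcs (n + m) (iter n (ad0 y) x).
Proof. by move=> lx; elim: n => //= n IH; apply: lcs_ad0. Qed.

(** By [fexp_bilinear], the self-bracket of the transformed point is exp (ad y) of the original
    self-bracket, which is zero. *)
Lemma gaugeN_MC y (xi : g 1) : curv xi = 0 -> curv (gaugeN M y xi) = 0.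
Proof.
rewrite !curv_dbr => /eqP; rewrite scaler_eq0 invr_eq0 (negbTE (natr_neq0 k0 _)) => /eqP xi0.
rewrite -!fexp_grho -(fexp_bilinear k0 (c := ad0 y) dbr_linl dbr_linr) ?xi0.
- rewrite /fexp big1 ?scaler0 // => i _; rewrite (_ : iter _ _ _ = 0) ?scaler0 //.
  by elim: (val i) => //= n ->; rewrite linear0.
- by move=> a x z; rewrite linearP.
- exact: ad0_dbr.
have grho0 n q : (c < n)%N -> iter n (grho y) q = 0.
  have Giter m : grhoF m (iter m (grho y) q).
    by elim: m => // m IH; apply: grho_grhoF.
  move=> /subnK <-; rewrite iterD (vf_nil (grhoFP gc) (Giter _)).
  elim: (n - _)%N => //= m ->.
  by rewrite /grho /= linear0 scale0r subr0.
move=> i j ij; case: (ltnP c i) => ci.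
  by rewrite grho0 // /dbr /= br0l linear0 !scaler0 mulr0 mul0r scale0r !addr0 scale0r ?addr0.
rewrite [iter j _ _]grho0; last by lia.
by rewrite /dbr /= !linear0 ?scale0r ?scaler0 ?mulr0 ?scale0r ?addr0. 
Qed.

(** The series starts with z = [y, xi] - d y and its other terms are iterated brackets of y with z.
    If the sum is zero, z lies one step deeper in the lower central series than assumed, hence in
    every step. *)
Lemma gaugeN_fix y (xi : g 1) : gaugeN M y xi = xi -> ad0 y xi = cl_d (add0r 1) y.
Proof.
rewrite /gaugeN => /eqP; rewrite -subr_eq0 addrAC subrr add0r => /eqP sum0.
apply/eqP; rewrite -subr_eq0; apply/eqP; set z := _ - _.
suff lz n : lcs n z by apply: gc (lz c).
elim: n => [|n IH]; first exact: lcs_top.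
have M0 : (0 < M)%N by lia.
move: sum0; rewrite -(prednK M0) big_ord_recl /gauge_term /= (_ : 1`!%:R = 1 :> k) // invr1
  scale1r -/z.
move=> /eqP; rewrite addr_eq0 => /eqP ->; rewrite -scaleN1r; apply: lcsZ.
apply: lcs_sum => i _; apply: lcsZ; rewrite -iterS.
by apply: (@lcsW _ _ _ (i.+1 + n)%N); [lia|apply: lcs_iter].
Qed.

End GaugeNilpotent.

(** * Convergence in pronilpotent curved Lie algebras *)

(* Convergence for the algebraic lower central series.  Unlike [sums_to] it is
   preserved by every homomorphism, continuous or not. *)
Definition lcs_sums (k : fieldType) (g : curvedLie k) (i : int)
    (u : nat -> g i) (s : g i) : Prop :=
  forall n, lcs n (s - \sum_(0 <= r < n.+1) u r).

Definition separated (k : fieldType) (g : curvedLie k) (C : nilCone g) : Prop :=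
  forall i (x y : g i), (forall a, nc_proj C a i x = nc_proj C a i y) -> x = y.

Lemma lcs_sums_hom (k : fieldType) (g h : curvedLie k) (f : curvedHom g h) i (u : nat -> g
  i) s :
  lcs_sums u s -> lcs_sums (fun r => f i (u r)) (f i s).
Proof.
by move=> us n; rewrite -linear_sum -linearB; apply: lcs_hom.
Qed.

Lemma lcs_sums_nil (k : fieldType) (g : curvedLie k) c i (u : nat -> g i) s :
  (forall j (x : g j), lcs c x -> x = 0) -> lcs_sums u s ->
  forall n, (c < n)%N -> \sum_(0 <= r < n) u r = s.
Proof.
move=> gc us [|n] // cn; apply/esym/eqP; rewrite -subr_eq0; apply/eqP.
by apply: gc; apply: lcsW (us n).
Qed.

Section LcsSums.
Context (k : fieldType) (g : curvedLie k).

Lemma lcs_sums_cone (C : nilCone g) i (u : nat -> g i) s :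
  lcs_sums u s -> sums_to C u s.
Proof.
move=> us a; have [c ac] := nc_nil C a; exists c.+1 => n cn.
by rewrite linear_sum (lcs_sums_nil ac (lcs_sums_hom _ us)).
Qed.

Lemma sums_to_uniq (C : nilCone g) i (u : nat -> g i) s t :
  separated C -> sums_to C u s -> sums_to C u t -> s = t.
Proof.
move=> sC us ut; apply: sC => a; have [N hN] := us a; have [N' hN'] := ut a.
by rewrite -(hN (maxn N N')) ?leq_maxl // (hN' (maxn N N')) ?leq_maxr.
Qed.

Lemma series_sumE (C : nilCone g) i (u : nat -> g i) s :
  separated C -> sums_to C u s -> series_sum C u = s.
Proof.
move=> sC us; rewrite /series_sum; case: xgetP => [t _ ut|no].
  exact: sums_to_uniq ut us.
by case: (no s).
Qed.

Section Operations.
Context (C : nilCone g).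

Lemma sums_toD i (u v : nat -> g i) s t : sums_to C u s -> sums_to C v t ->
  sums_to C (fun r => u r + v r) (s + t).
Proof.
move=> us vt a; have [N hN] := us a; have [N' hN'] := vt a.
exists (maxn N N') => n; rewrite geq_max => /andP[Nn N'n].
by rewrite big_split !linearD /= hN // hN'.
Qed.

Lemma sums_toB i (u v : nat -> g i) s t : sums_to C u s -> sums_to C v t ->
  sums_to C (fun r => u r - v r) (s - t).
Proof.
move=> us vt a; have [N hN] := us a; have [N' hN'] := vt a.
exists (maxn N N') => n; rewrite geq_max => /andP[Nn N'n].
by rewrite sumrB !linearB /= hN // hN'.
Qed.

Lemma sums_to_ad0 i (y : g 0) (u : nat -> g i) s : sums_to C u s ->
  sums_to C (fun r => ad0 y (u r)) (ad0 y s).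
Proof.
move=> us a; have [N hN] := us a; exists N => n Nn.
by rewrite -linear_sum /= /ad0 !ch_br hN.
Qed.

Lemma sums_to_d i j (e : i + 1 = j) (u : nat -> g i) s : sums_to C u s ->
  sums_to C (fun r => cl_d e (u r)) (cl_d e s).
Proof.
move=> us a; have [N hN] := us a; exists N => n Nn.
by rewrite -linear_sum /= !ch_d hN.
Qed.

Lemma sums_to_shift i (u : nat -> g i) s :
  sums_to C (fun r => u r.+1) s -> sums_to C u (u 0%N + s).
Proof.
move=> us a; have [N hN] := us a; exists N.+1 => -[|n] // Nn.
by rewrite big_nat_recl // !linearD /= hN.
Qed.

End Operations.
End LcsSums.

(** * Convergence of the gauge and BCH series *)

Section Completeness.
Context (k : fieldType) (g : curvedLie k) (P : pronilpotent g).

Lemma pronilpotent_separated : separated P.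
Proof. exact: proj_inj. Qed.

(** In each nilpotent member of the system all terms from some index on vanish. The stable values of
    the partial sums form a compatible family, which has a limit. *)
Lemma sums_to_ex i (u : nat -> g i) : (forall n, lcs n.-1 (u n)) ->
  exists s, sums_to P u s.
Proof.
move=> lu.
have /choice [c hc] : forall a, exists c, forall i (x : nc_obj P a i), lcs c x -> x = 0.
  by move=> a; apply: (nc_nil P a).
pose U a := nc_proj P a i (\sum_(0 <= r < (c a).+2) u r).
have stab a n : ((c a).+2 <= n)%N -> nc_proj P a i (\sum_(0 <= r < n) u r) = U a.
  move=> cn; rewrite (@big_cat_nat _ _ _ (c a).+2) //= linearD /= -[RHS]addr0.
  congr (_ + _); rewrite linear_sum big_nat big1 // => r /andP[cr _].
  by apply: hc; apply: lcs_hom; apply: lcsW (lu r); lia.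
have [|s [hs _]] := @pn_lim k g P i U.
  move=> a b ab; rewrite -(stab b (maxn (c a).+2 (c b).+2)) ?leq_maxr //.
  by rewrite pn_proj stab // leq_maxl.
by exists s => a; exists (c a).+2 => n cn; rewrite stab.
Qed.

(** Each term after the first contains a factor [ad0 y], which can be pulled out of the convergent
    tail by continuity. Iterating exhibits the remainder as an actual iterated bracket, so it lies
    in the algebraic lower central series and not merely in its closure. *)
Lemma lcs_sums_pow (y : g 0) i (z : g i) (a : nat -> k) s :
  sums_to P (fun r => a r *: iter r (ad0 y) z) s ->
  lcs_sums (fun r => a r *: iter r (ad0 y) z) s.
Proof.
move=> us n; apply: lcsS; elim: n.+1 a s us => [|m IH] b s us; first exact: lcs_top.
pose v r := b r.+1 *: iter r (ad0 y) z.
have [|t vt] := @sums_to_ex i v.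
  by move=> r; apply: lcsZ; apply: (@lcsW _ _ _ (r + 0)%N); [lia|apply: lcs_iter (lcs_top _)].
have -> : s = b 0%N *: z + ad0 y t.
  apply: (sums_to_uniq pronilpotent_separated us).
  rewrite -[z in b 0%N *: z]/(iter 0 (ad0 y) z).
  apply: (sums_to_shift (u := fun r => b r *: iter r (ad0 y) z)).
  have := sums_to_ad0 y vt; congr (sums_to _ _ _).
  by apply: funext => r; rewrite /v linearZ.
rewrite big_nat_recl // opprD addrACA subrr add0r.
rewrite [X in _ - X](_ : _ = ad0 y (\sum_(0 <= r < m) v r)); last first.
  by rewrite linear_sum; apply: eq_bigr => r _; rewrite /v linearZ.
by rewrite -linearB; apply: lcs_ad0; apply: IH.
Qed.

Lemma gauge_sums (y : g 0) (xi : g 1) :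
  lcs_sums (gauge_term y xi) (gauge P y xi - xi).
Proof.
have [|s us] := @sums_to_ex 1 (gauge_term y xi).
  by move=> r; apply: lcsZ; apply: (@lcsW _ _ _ (r + 0)%N); [lia|apply: lcs_iter (lcs_top _)].
rewrite /gauge (series_sumE pronilpotent_separated us) addrC addKr.
exact: lcs_sums_pow.
Qed.

(** The span of right-nested brackets of length n in x and y, arranged by outermost letter so that a
    whole series of such terms can be factored through [ad0 x] and [ad0 y]. *)
Fixpoint word_span (x y : g 0) n (t : g 0) : Prop :=
  match n with
  | 0 => t = 0
  | m.+1 => if m is 0 then exists a b : k, t = a *: x + b *: y
            else exists u v, [/\ word_span x y m u, word_span x y m v
                              & t = ad0 x u + ad0 y v]
  end.

Lemma word_span_lin x y n a s t : word_span x y n s -> word_span x y n t ->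
  word_span x y n (a *: s + t).
Proof.
elim: n a s t => [|[|n] IH] a s t.
- by move=> -> ->; rewrite scaler0 addr0.
- move=> [b [c ->]] [b' [c' ->]]; exists (a * b + b'), (a * c + c').
  by rewrite scalerDr !scalerA addrACA !scalerDl.
- move=> [u [v [us vs ->]]] [u' [v' [us' vs' ->]]].
  exists (a *: u + u'), (a *: v + v'); split; [exact: IH|exact: IH|].
  by rewrite !linearP scalerDr addrACA.
Qed.

Lemma word_span0 x y n : word_span x y n 0.
Proof.
elim: n => [|[|n] IH] //; first by exists 0, 0; rewrite !scale0r addr0.
by exists 0, 0; split=> //; rewrite !linear0 addr0.
Qed.

Lemma word_span_sum x y n I (r : seq I) (Q : pred I) (U : I -> g 0) :
  (forall i, Q i -> word_span x y n (U i)) -> word_span x y n (\sum_(i <- r | Q i) U i).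
Proof.
move=> hU; elim/big_ind: _ => //; first exact: word_span0.
by move=> s t hs ht; rewrite -[s]scale1r; apply: word_span_lin.
Qed.

Lemma word_span_nbr x y (w : seq bool) :
  word_span x y (size w) (nbr (@ad0 k g 0) (map (fun b : bool => if b then x else y) w)).
Proof.
elim: w => [|b [|b' w] IH] //.
  by case: b; [exists 1, 0|exists 0, 1]; rewrite scale1r scale0r ?addr0 ?add0r.
case: b; [exists (nbr (@ad0 k g 0) (map (fun b : bool => if b then x else y) (b' :: w))), 0
  |exists 0, (nbr (@ad0 k g 0) (map (fun b : bool => if b then x else y) (b' :: w)))];
  by split=> //; [exact: word_span0|rewrite linear0 ?addr0 ?add0r].
Qed.

Lemma bch_term_span x y n : word_span x y n (bch_term x y n).
Proof.
rewrite bch_termE bcht_bword; apply: word_span_sum => m _.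
apply: word_span_sum => p /andP[_ /eqP sp]; rewrite -[_ *: _]addr0.
apply: word_span_lin (word_span0 _ _ _).
by rewrite -{1}sp -(size_bword (fun i => (val (p i).1, val (p i).2))); apply: word_span_nbr.
Qed.

Lemma lcs_word_span x y n t : word_span x y n t -> lcs n.-1 t.
Proof.
elim: n t => [|[|n] IH] t; [by move=> ->; exact: lcs0|by move=> _; exact: lcs_top|].
by move=> [u [v [us vs ->]]]; apply: lcsD; apply: lcs_ad0; apply: IH.
Qed.

(** Splitting off the outermost letter writes the tail as [x, s1] + [y, s2] for two convergent
    series of the same kind. Induction then puts the remainder in the lower central series by
    finitely many brackets. *)
Lemma lcs_sums_words x y (u : nat -> g 0) s : (forall n, word_span x y n (u n)) ->
  sums_to P u s -> lcs_sums u s.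
Proof.
move=> hu us n; elim: n u s hu us => [|n IH] u s hu us; first exact: lcs_top.
(* The term of index 1 is a combination of letters and not a bracket; the decomposition starts at
   index 2 and [u 1] is kept apart. *)
have /choice [v hv] : forall r, exists v : g 0 * g 0,
    [/\ word_span x y r v.1, word_span x y r v.2
      & (0 < r)%N -> u r.+1 = ad0 x v.1 + ad0 y v.2].
  case=> [|r]; first by exists (0, 0).
  by have [a [b [ha hb hab]]] := hu r.+2; exists (a, b).
have [|s1 hs1] := @sums_to_ex 0 (fun r => (v r).1).
  by move=> r; have [h _ _] := hv r; apply: lcs_word_span h.
have [|s2 hs2] := @sums_to_ex 0 (fun r => (v r).2).
  by move=> r; have [_ h _] := hv r; apply: lcs_word_span h.
have IH1 := IH _ _ (fun r => let: And3 h _ _ := hv r in h) hs1.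
have IH2 := IH _ _ (fun r => let: And3 _ h _ := hv r in h) hs2.
have [v01 v02 _] := hv 0%N.
pose w r := ad0 x (v r).1 + ad0 y (v r).2.
have w0 : w 0%N = 0 by rewrite /w v01 v02 !linear0 addr0.
have ws : sums_to P w (ad0 x s1 + ad0 y s2).
  by apply: sums_toD; apply: sums_to_ad0.
have u0 : u 0%N = 0 := hu 0%N.
have u2 m : \sum_(0 <= r < m.+2) u r = u 1%N + \sum_(0 <= r < m.+1) w r.
  rewrite !big_nat_recl // u0 w0 !add0r; congr (_ + _).
  by apply: eq_bigr => r _; have [_ _ ->] := hv r.+1.
have -> : s = u 1%N + (ad0 x s1 + ad0 y s2).
  apply: (sums_to_uniq pronilpotent_separated us) => a.
  have [N hN] := ws a; exists N.+2 => -[|[|m]] // Nm.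
  by rewrite u2 linearD [RHS]linearD /= hN //; apply: ltnW.
rewrite u2 opprD addrACA subrr add0r.
rewrite big_split /= -!linear_sum /= opprD addrACA -!linearB.
by apply: lcsD; apply: lcs_ad0; rewrite raddf_sum; [exact: IH1|exact: IH2].
Qed.

Lemma bch_sums (x y : g 0) : lcs_sums (bch_term x y) (bch P x y).
Proof.
have [|s us] := @sums_to_ex 0 (bch_term x y).
  by move=> n; apply: lcs_word_span; apply: bch_term_span.
rewrite /bch (series_sumE pronilpotent_separated us).
by apply: lcs_sums_words us; apply: bch_term_span.
Qed.

End Completeness.

(** * Homomorphisms commute with BCH and the gauge action *)

Section Homomorphisms.
Context (k : fieldType) (g : curvedLie k) (P : pronilpotent g).

Lemma hom_ad0 (h : curvedLie k) (f : curvedHom g h) i (y : g 0) (x : g i) :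
  f i (ad0 y x) = ad0 (f 0 y) (f i x).
Proof. exact: ch_br. Qed.

Lemma hom_bch_term (h : curvedLie k) (f : curvedHom g h) (x y : g 0) n :
  f 0 (bch_term x y n) = bch_term (f 0 x) (f 0 y) n.
Proof. by rewrite !bch_termE; apply: bcht_map => u v; apply: hom_ad0. Qed.

Lemma hom_gauge_term (h : curvedLie k) (f : curvedHom g h) (y : g 0) (xi : g 1) r :
  f 1 (gauge_term y xi r) = gauge_term (f 0 y) (f 1 xi) r.
Proof.
rewrite /gauge_term linearZ /= -hom_ad0 -ch_d -linearB; congr (_ *: _).
by elim: r => //= r IH; rewrite hom_ad0 IH.
Qed.

Lemma hom_bchN (h : curvedLie k) (f : curvedHom g h) c M (x y : g 0) :
  (forall i (z : h i), lcs c z -> z = 0) -> (c < M)%N ->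
  f 0 (bch P x y) = bchN (@ad0 k h 0) M (f 0 x) (f 0 y).
Proof.
move=> hc cM; rewrite -(lcs_sums_nil hc (lcs_sums_hom f (bch_sums P x y)) cM).
by rewrite big_mkord; apply: eq_bigr => n _; rewrite hom_bch_term bch_termE.
Qed.

Lemma hom_gaugeN (h : curvedLie k) (f : curvedHom g h) c M (y : g 0) (xi : g 1) :
  (forall i (z : h i), lcs c z -> z = 0) -> (c < M)%N ->
  f 1 (gauge P y xi) = gaugeN M (f 0 y) (f 1 xi).
Proof.
move=> hc cM; rewrite -[gauge _ _ _](subrK xi) addrC linearD; congr (_ + _).
apply: etrans (esym (lcs_sums_nil hc (lcs_sums_hom f (gauge_sums P y xi)) cM)) _.
by rewrite big_mkord; apply: eq_bigr => n _; rewrite hom_gauge_term.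
Qed.

(** The image of a remainder lies in the lower central series of the target, so the image series
    sums to the image of the sum; limits are unique. *)
Lemma hom_bch (h : curvedLie k) (Q : pronilpotent h) (f : curvedHom g h) x y :
  f 0 (bch P x y) = bch Q (f 0 x) (f 0 y).
Proof.
apply: (sums_to_uniq (pronilpotent_separated (P := Q)) _ (lcs_sums_cone (bch_sums Q _ _))).
have := lcs_sums_cone (C := Q) (lcs_sums_hom f (bch_sums P x y)).
by congr sums_to; apply: funext => n; apply: hom_bch_term.
Qed.

Lemma hom_gauge (h : curvedLie k) (Q : pronilpotent h) (f : curvedHom g h) y xi :
  f 1 (gauge P y xi) = gauge Q (f 0 y) (f 1 xi).
Proof.
apply: (addIr (- f 1 xi)); rewrite -linearB.
apply: (sums_to_uniq (pronilpotent_separated (P := Q)) _ (lcs_sums_cone (gauge_sums Q _ _))).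
have := lcs_sums_cone (C := Q) (lcs_sums_hom f (gauge_sums P y xi)).
by congr sums_to; apply: funext => n; apply: hom_gauge_term.
Qed.

End Homomorphisms.

(** * The group law and the gauge action in the pronilpotent case *)

Section GaugeGroup.
Context (k : fieldType) (k0 : has_pchar0 k) (g : curvedLie k) (P : pronilpotent g).

(** Reduces each identity to nilpotent targets, where all series are finite sums. *)
Let ext i (x y : g i) :
  (forall (n : curvedLie k) (f : curvedHom g n) c,
     (forall i (z : n i), lcs c z -> z = 0) -> f i x = f i y) -> x = y.
Proof.
move=> xy; apply: (pronilpotent_separated (P := P)) => a.
by have [c hc] := nc_nil P a; apply: xy hc.
Qed.

Lemma bchA : associative (bch P).
Proof.
(* The order [(c.*2).+2] is twice [c.+1], the least truncation allowed by [bchNA] for class [c]. *)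
move=> x y z; apply: ext => n f c nc; have cM : (c < (c.*2).+2)%N by lia.
rewrite !(hom_bchN P f _ _ nc cM).
rewrite (bchNA k0 (ad0_lie n) (lcs_vfilt nc 0)) //.
by move=> *; apply: lcs_ad0.
Qed.

Lemma bch0l : left_id 0 (bch P).
Proof.
move=> x; apply: ext => n f c nc; have cM : (c < (c.*2).+2)%N by lia.
rewrite !(hom_bchN P f _ _ nc cM) linear0.
rewrite (bchN0l k0 (ad0_lie n) (lcs_vfilt nc 0)) //.
by move=> *; apply: lcs_ad0.
Qed.

Lemma bchNl x : bch P (- x) x = 0.
Proof.
apply: ext => n f c nc; have cM : (c < (c.*2).+2)%N by lia.
rewrite !(hom_bchN P f _ _ nc cM) linear0 linearN.
rewrite (bchNNl k0 (ad0_lie n) (lcs_vfilt nc 0)) //.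
by move=> *; apply: lcs_ad0.
Qed.

Lemma bchNr x : bch P x (- x) = 0.
Proof. by rewrite -{1}[x]opprK bchNl. Qed.

Lemma bch0r : right_id 0 (bch P).
Proof. by move=> x; rewrite -(bchNl x) bchA bchNr bch0l. Qed.

Lemma gauge_bch y z xi : gauge P y (gauge P z xi) = gauge P (bch P y z) xi.
Proof.
apply: ext => n f c nc; have cM : (c < (c.*2).+1)%N by lia.
have cM' : (c < (c.*2).+2)%N by lia.
rewrite !(hom_gaugeN P f _ _ nc cM) (hom_bchN P f _ _ nc cM').
by rewrite (gaugeN_bch k0 _ _ _ nc).
Qed.

Lemma gauge_fix y xi : ad0 y xi = cl_d (add0r 1) y -> gauge P y xi = xi.
Proof.
move=> yxi; apply: ext => n f c nc.
rewrite (hom_gaugeN P f _ _ nc (ltnSn c)) /gaugeN big1 ?addr0 // => r _.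
rewrite -hom_gauge_term /gauge_term yxi subrr (_ : iter _ _ _ = 0) ?scaler0 ?linear0 //.
by elim: (val r) => //= m ->; rewrite linear0.
Qed.

Lemma gauge0 xi : gauge P 0 xi = xi.
Proof. by apply: gauge_fix; rewrite /ad0 br0l linear0. Qed.

Lemma gauge_fix_inv y xi : gauge P y xi = xi -> ad0 y xi = cl_d (add0r 1) y.
Proof.
move=> yxi; apply: ext => n f c nc; have cM : (c < (c.*2).+1)%N by lia.
rewrite hom_ad0 ch_d; apply: (gaugeN_fix nc (M := (c.*2).+1)) => //.
by rewrite -(hom_gaugeN P f _ _ nc cM) yxi.
Qed.

Lemma gauge_curv y xi : curv xi = 0 -> curv (gauge P y xi) = 0.
Proof.
move=> xi0; apply: ext => n f c nc; have cM : (c < (c.*2).+1)%N by lia.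
rewrite hom_curv (hom_gaugeN P f _ _ nc cM) linear0.
by apply: (gaugeN_MC k0 nc) => //; rewrite -hom_curv xi0 linear0.
Qed.

Lemma gaugeK y xi : gauge P (- y) (gauge P y xi) = xi.
Proof. by rewrite gauge_bch bchNl gauge0. Qed.

End GaugeGroup.

(** * Invariance of BCH under change of cocycle representatives *)

Section Coboundaries.
Context (k : fieldType) (g : curvedLie k) (P : pronilpotent g).

(** The depth of the primitive in the lower central series is recorded so that a series of
    primitives converges. *)
Definition cobounds n (t : g 0) := exists2 v : g (- 1), lcs n v & t = cl_d (addNr 1) v.

Lemma cobounds_lin n a s t : cobounds n s -> cobounds n t -> cobounds n (a *: s + t).
Proof.
move=> [u lu ->] [v lv ->]; exists (a *: u + v); first exact: lcs_lin.
by rewrite linearP.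
Qed.

Lemma cobounds0 n : cobounds n 0.
Proof. by exists 0; rewrite ?linear0 //; apply: lcs0. Qed.

(** Induction from [u, s] - [v, t] = [u - v, s] + [v, s - t]: if u - v = d p and s - t = d q, this
    is d ([p, s] + [v, q]), because s and v are cocycles. *)
Lemma nested_cobounds (u v : bool -> g 0) (w : seq bool) :
  (forall b, cl_d (add0r 1) (u b) = 0) -> (forall b, cl_d (add0r 1) (v b) = 0) ->
  (forall b, cobounds 0 (u b - v b)) ->
  cobounds (size w).-1 (nested_br (map u w) - nested_br (map v w)).
Proof.
move=> du dv uv; elim: w => [|b [|b' w] IH]; first by rewrite subrr; apply: cobounds0.
  exact: uv.
have -> : nested_br (map u [:: b, b' & w]) = ad0 (u b) (nested_br (map u (b' :: w))) by [].
have -> : nested_br (map v [:: b, b' & w]) = ad0 (v b) (nested_br (map v (b' :: w))) by [].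
have dn : cl_d (add0r 1) (nested_br (map u (b' :: w))) = 0.
  by apply: nested_br_cocycle => z /mapP [c _ ->].
have ln : lcs (size w) (nested_br (map u (b' :: w))).
  by have := lcs_nested (map u (b' :: w)); rewrite size_map.
move: (nested_br (map u _)) (nested_br (map v _)) IH dn ln => s t [q lq st] ds ls.
have [p _ uvp] := uv b.
exists (cl_br (addr0 (- 1)) p s + ad0 (v b) q).
  by apply: lcsD; [exact: lcs_br ls|exact: lcs_ad0 lq].
rewrite linearD /=.
rewrite (cl_leibniz _ _ (addNr 1) (add0r 1) (add0r 0) (addNr 1)) ds linear0 scaler0 addr0 -uvp.
rewrite /ad0 (cl_leibniz _ _ (add0r 1) (addNr 1) (addrN 1) (add0r 0)) dv br0l add0r.
rewrite expr0z scale1r -st linearB /= brDl brNl.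
by rewrite addrA subrK.
Qed.

(** Term by term the difference has primitives of growing depth. Their series converges, and d
    passes through the limit. *)
Lemma bch_cobound (x x' y y' : g 0) :
  cl_d (add0r 1) x = 0 -> cl_d (add0r 1) x' = 0 ->
  cl_d (add0r 1) y = 0 -> cl_d (add0r 1) y' = 0 ->
  (exists w, x' - x = cl_d (addNr 1) w) -> (exists w, y' - y = cl_d (addNr 1) w) ->
  exists w, bch P x' y' - bch P x y = cl_d (addNr 1) w.
Proof.
move=> dx dx' dy dy' [w xw] [z yz].
have /choice [v hv] : forall n, exists v : g (- 1),
    lcs n.-1 v /\ bch_term x' y' n - bch_term x y n = cl_d (addNr 1) v.
  move=> n; suff [v] : cobounds n.-1 (bch_term x' y' n - bch_term x y n) by exists v.
  rewrite !bch_termE !bcht_bword -sumrB; apply: big_ind => [|s t hs ht|m _].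
  - exact: cobounds0.
  - by rewrite -[s]scale1r; apply: cobounds_lin.
  rewrite -sumrB; apply: big_ind => [|s t hs ht|p /andP[_ /eqP sp]].
  - exact: cobounds0.
  - by rewrite -[s]scale1r; apply: cobounds_lin.
  rewrite -scalerBr -[_ *: _]addr0; apply: cobounds_lin (cobounds0 _).
  rewrite -!nested_nbr -{1}sp -(size_bword (fun i => (val (p i).1, val (p i).2))).
  apply: nested_cobounds => -[] //.
  - by exists w => //; apply: lcs_top.
  - by exists z => //; apply: lcs_top.
have [|s vs] := @sums_to_ex _ _ P _ v; first by move=> n; case: (hv n).
exists s; apply: (sums_to_uniq (pronilpotent_separated (P := P)) _ (sums_to_d _ vs)).
have := sums_toB (lcs_sums_cone (C := P) (bch_sums P x' y')) (lcs_sums_cone (bch_sums P x y)).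
by congr sums_to; apply: funext => n; case: (hv n).
Qed.

End Coboundaries.

(** * The fibre of the Maurer-Cartan moduli set *)

Section QuotientFacts.
Context (T : choiceType) (R : T -> T -> Prop).

Lemma clsP x y : cls R x = cls R y <-> clos_refl_sym_trans T R x y.
Proof.
split=> [/eqP|xy].
  by rewrite /cls eqmodE => /asboolP.
by apply/eqP; rewrite /cls eqmodE; apply/asboolP.
Qed.

Lemma repK c : cls R (rep (R := R) c) = c.
Proof. exact: reprK. Qed.

Lemma cls_ind (E : T -> T -> Prop) : (forall x, E x x) ->
  (forall x y, E x y -> E y x) -> (forall x y z, E x y -> E y z -> E x z) ->
  (forall x y, R x y -> E x y) -> forall x y, cls R x = cls R y -> E x y.
Proof.
move=> Er Es Et RE x y /clsP; elim=> {x y} [x y /RE|x|x y _ /Es|x y z _ xy _] //.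
exact: Et xy.
Qed.

Lemma cls_step x y : R x y -> cls R x = cls R y.
Proof. by move=> xy; apply/clsP; apply: rst_step. Qed.

End QuotientFacts.

(** * The group of exponentials of degree 0 cohomology classes *)

Section ExpGroup.
Context (k : fieldType) (k0 : has_pchar0 k) (a : curvedLie k) (P : pronilpotent a).

Lemma H0clsP (x y : Z0 a) :
  H0cls x = H0cls y <-> exists w, z0_val y - z0_val x = cl_d (addNr 1) w.
Proof.
split=> [|[w xy]]; last by apply/esym/cls_step; exists w.
pose E (x y : Z0 a) := exists w, z0_val y - z0_val x = cl_d (addNr 1) w.
apply: (cls_ind (E := E)) => {x y}.
- by move=> x; exists 0; rewrite subrr linear0.
- by move=> x y [w xy]; exists (- w); rewrite linearN /= -xy opprB.
- by move=> x y z [v xy] [w yz]; exists (v + w); rewrite linearD /= -xy -yz [RHS]addrC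
  addrA subrK.
- by move=> x y [w xy]; exists (- w); rewrite linearN /= -xy opprB.
Qed.

Lemma exp_mul_cls (x y : Z0 a) :
  exp_mul P (H0cls x) (H0cls y) = H0cls (exist _ (bch P (z0_val x) (z0_val y)) (Z0_bchP P x y)).
Proof.
apply/H0clsP; apply: bch_cobound; try exact: z0_valP.
- by apply/H0clsP; rewrite [LHS]repK.
- by apply/H0clsP; rewrite [LHS]repK.
Qed.

Lemma H0cls_eq (x y : Z0 a) : z0_val x = z0_val y -> H0cls x = H0cls y.
Proof. by move=> xy; apply/H0clsP; exists 0; rewrite xy subrr linear0. Qed.

Lemma H0_surj (c : H0 a) : exists x, c = H0cls x.
Proof. by exists (rep c); rewrite /H0cls repK. Qed.

Lemma exp_mulA : associative (exp_mul P).
Proof.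
move=> c c' c''; have [x ->] := H0_surj c; have [y ->] := H0_surj c'.
have [z ->] := H0_surj c''; rewrite !exp_mul_cls.
by apply: H0cls_eq; apply: bchA.
Qed.

Lemma exp_mul1l : left_id (exp_one a) (exp_mul P).
Proof.
move=> c; have [x ->] := H0_surj c; rewrite exp_mul_cls.
by apply: H0cls_eq; apply: bch0l.
Qed.

Lemma exp_mulVl : left_inverse (exp_one a) (@exp_inv k a) (exp_mul P).
Proof.
move=> c; have {2}<- : H0cls (rep c) = c by apply: repK.
rewrite exp_mul_cls.
by apply: H0cls_eq; apply: bchNl.
Qed.

End ExpGroup.

Section GaugeClasses.
Context (k : fieldType) (k0 : has_pchar0 k) (g : curvedLie k) (P : pronilpotent g).

Lemma MCclsP (xi xi' : MC g) : MCcls P xi = MCcls P xi' <->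
  exists y, mc_val xi' = gauge P y (mc_val xi).
Proof.
split=> [|xy]; last exact: cls_step.
apply: (cls_ind (E := gauge_step P)) => // {xi xi'}.
- by move=> x; exists 0; rewrite gauge0.
- by move=> x y [u xy]; exists (- u); rewrite xy gaugeK.
- by move=> x y z [u xy] [v yz]; exists (bch P v u); rewrite yz xy gauge_bch.
Qed.

End GaugeClasses.

(** * Cocycles moving solutions over the base point *)

Section FibreAction.
Context (k : fieldType) (k0 : has_pchar0 k) (g h : curvedLie k).
Context (gP : pronilpotent g) (hP : pronilpotent h) (f : curvedHom g h).
Context (fsurj : forall i (y : h i), exists x, f i x = y).
Context (xi0 : MC h) (xi : g 1) (fxi : f 1 xi = mc_val xi0).
Local Notation hxi0 := (twist k0 (mc_val xi0)).
Local Notation hP0 := (twist_pronilpotent k0 (mc_val xi0) hP).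
Local Notation kxi := (fibre_lie k0 fxi).
Local Notation kC := (fibre_cone k0 fxi gP).

Definition sh (eta : MC kxi) : g 1 := mc_val (MC_shift eta).

Lemma br1_ad0 (g' : curvedLie k) (y : g' 0) (z : g' 1) (e : 1 + 0 = 1) :
  cl_br e z y = - ad0 y z.
Proof. by rewrite (cl_anti e (add0r 1)) mulr0 expr0z scale1r. Qed.

Lemma tw_d0 (g' : curvedLie k) (z : g' 1) (y : g' 0) :
  tw_d z (add0r 1) y = cl_d (add0r 1) y - ad0 y z.
Proof. by rewrite /tw_d br1_ad0. Qed.

Lemma fibre_separated : separated kC.
Proof.
move=> i x y xy; apply: val_inj; apply: (pronilpotent_separated (P := gP)) => a.
exact: xy.
Qed.

Definition ker_elt i (z : g i) (fz : f i z = 0) : kxi i :=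
  @KerSort k (twist k0 xi) hxi0 (twist_hom k0 fxi) i z (introT eqP fz).

(** The twist absorbs the shift: [u, eta] - d^xi u = [u, eta + xi] - d u. *)
Lemma shift_gauge_term (u : kxi 0) (eta : kxi 1) r :
  gauge_term (ker_val u : g 0) (shift eta) r = ker_val (gauge_term u eta r) :> g 1.
Proof.
rewrite /gauge_term [RHS]/(_ *: ker_val _); congr (_ *: _).
elim: r => [|r IH]; last by rewrite iterS IH.
rewrite /= /shift linearD /= -[RHS]/((ad0 (ker_val u : g 0) (ker_val eta) : g 1) - tw_d xi
  (add0r 1) (ker_val u)).
by rewrite tw_d0 opprB addrA.
Qed.

(** The terms agree by [shift_gauge_term]. As f kills every term and carries sums to sums, the limit
    taken in [g] lies in the kernel and is also the limit there. *)
Lemma shift_gauge (u : kxi 0) (eta : kxi 1) :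
  shift (gauge kC u eta) = gauge gP (ker_val u) (shift eta).
Proof.
have us := gauge_sums gP (ker_val u : g 0) (shift eta).
set s := _ - _ in us.
have fs : f 1 s = 0.
  apply: (pronilpotent_separated (P := hP)) => b; rewrite linear0.
  have [c hc] := nc_nil hP b.
  have /(lcs_sums_nil hc)/(_ _ (ltnSn c)) <- := lcs_sums_hom (nc_proj hP b) (lcs_sums_hom f us).
  rewrite big1 // => r _; rewrite shift_gauge_term.
  by have /eqP -> := ker_valP (gauge_term u eta r); rewrite linear0.
have ss : sums_to kC (gauge_term u eta) (ker_elt fs).
  move=> a; have [N hN] := lcs_sums_cone (C := gP) us a; exists N => n Nn.
  rewrite -[RHS]/(nc_proj gP a 1 s) -(hN n Nn).
  have ksum : ker_val (\sum_(0 <= r < n) gauge_term u eta r) =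
      \sum_(0 <= r < n) gauge_term (ker_val u : g 0) (shift eta) r :> g 1.
    elim: n {Nn} => [|n IH]; first by rewrite !big_nil.
    rewrite !big_nat_recr //= -IH shift_gauge_term.
    by [].
  by rewrite -ksum.
have -> : gauge kC u eta = eta + ker_elt fs.
  by rewrite /gauge -[RHS](congr1 (fun t => eta + t) (series_sumE fibre_separated ss)).
rewrite /shift -[ker_val (_ + _)]/((ker_val eta : g 1) + s) addrAC.
by rewrite -/(shift eta) /s addrC subrK.
Qed.

Lemma sh_surj (z : g 1) : curv z = 0 -> f 1 z = mc_val xi0 ->
  exists eta : MC kxi, sh eta = z.
Proof.
move=> z0 fz.
have kz : f 1 (z - xi) = 0 by rewrite linearB /= fz fxi subrr.
have cz : curv (ker_elt kz) == 0.
  apply/eqP; apply: val_inj; rewrite -[LHS]/(ker_val _) -curv_shift.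
  by rewrite /shift /= subrK z0.
exists (exist _ (ker_elt kz) cz).
exact: (subrK xi z).
Qed.

Lemma f_sh (eta : MC kxi) : f 1 (sh eta) = mc_val xi0.
Proof.
rewrite -[sh eta]/(shift (mc_val eta)) /shift linearD /= fxi.
by have /eqP -> := ker_valP (mc_val eta); rewrite add0r.
Qed.

Lemma curv_sh (eta : MC kxi) : curv (sh eta) = 0.
Proof. exact: mc_valP. Qed.

Lemma kclsP (eta eta' : MC kxi) : MCcls kC eta = MCcls kC eta' <->
  exists2 u : g 0, f 0 u = 0 & sh eta' = gauge gP u (sh eta).
Proof.
split=> [|[u fu uE]].
  apply: (cls_ind (E := fun eta eta' => exists2 u : g 0, f 0 u = 0 & sh eta' = gauge gP u
    (sh eta))) => {eta eta'}.
  - by move=> x; exists 0; rewrite ?linear0 // gauge0.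
  - by move=> x y [u fu uE]; exists (- u); rewrite ?linearN /= ?fu ?oppr0 // uE gaugeK.
  - move=> x y z [u fu uE] [v fv vE]; exists (bch gP v u).
      by rewrite (hom_bch gP hP) fu fv bch0l.
    by rewrite vE uE gauge_bch.
  - move=> x y [u uE]; exists (ker_val u : g 0).
      by have /eqP := ker_valP u.
    by rewrite -shift_gauge -uE.
apply: cls_step.
exists (ker_elt fu); apply: val_inj; apply: (addIr (xi : twist k0 xi 1)).
exact: etrans uE (esym (shift_gauge (ker_elt fu) (mc_val eta))).
Qed.

Lemma cocycle_fix (x : h 0) : cl_d (add0r 1) (x : hxi0 0) = 0 <->
  gauge hP x (mc_val xi0) = mc_val xi0.
Proof.
rewrite -[cl_d _ _]/(tw_d (mc_val xi0) (add0r 1) x) tw_d0; split.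
  by move=> /eqP; rewrite subr_eq0 => /eqP dx; apply: gauge_fix.
by move/gauge_fix_inv => ->; rewrite subrr.
Qed.

(** The action as a relation, with an arbitrary lift of the cocycle. Totality and compatibility with
    cohomology and gauge classes then make it a function on classes. *)
Definition moves (x : Z0 hxi0) (eta eta' : MC kxi) : Prop :=
  exists2 y : g 0, f 0 y = z0_val x & sh eta' = gauge gP y (sh eta).

Lemma moves_ex x eta : exists eta', moves x eta eta'.
Proof.
have [y fy] := fsurj (z0_val x : h 0).
have [||eta' he] := @sh_surj (gauge gP y (sh eta)).
- by apply: gauge_curv => //; apply: curv_sh.
- rewrite (hom_gauge gP hP) fy f_sh; apply/cocycle_fix; exact: z0_valP.
by exists eta'; exists y.
Qed.

(* The coboundary [d v] of [bch (- x) x'] lifts to [d^zeta V] for [zeta = sh eta],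
   which fixes [zeta]; so [x'] has a lift that moves [eta] as the lift of [x] does. *)
Lemma moves_cohomologous x x' eta eta' : H0cls x = H0cls x' ->
  moves x eta eta' -> moves x' eta eta'.
Proof.
move=> /H0clsP [w xw] [y fy yE].
(* Comparing the products of - x with x and with x' gives a coboundary, since the first product is
   0. *)
have [||||||v] := @bch_cobound _ _ hP0 (- z0_val x) (- z0_val x) (z0_val x) (z0_val x').
- exact/eqP/Z0_oppP.
- exact/eqP/Z0_oppP.
- exact: z0_valP.
- exact: z0_valP.
- by exists 0; rewrite subrr linear0.
- by exists w.
rewrite (bchNl k0 hP0) subr0 => vE.
have [V fV] := fsurj (v : h (- 1)).
pose p := tw_d (sh eta) (addNr 1) V.
have fp : f 0 p = bch hP (- (z0_val x : h 0)) (z0_val x').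
  rewrite -[RHS]/(@bch k hxi0 hP0 _ _) vE /p /tw_d linearD /= ch_d ch_br fV f_sh.
  by [].
exists (bch gP y p).
  by rewrite (hom_bch gP hP) fp fy (bchA k0) bchNr // bch0l.
rewrite -gauge_bch // [gauge gP p _]gauge_fix //.
apply/esym/eqP; rewrite -subr_eq0 -tw_d0; apply/eqP.
(* The square of the twisted differential is the bracket with the curvature of zeta, which
   vanishes. *)
by rewrite /p (tw_dd k0 _ (addNr 1) (add0r 1) (erefl : 2%:R + -1 = 1 :> int)) curv_sh br0l.
Qed.

(** The results differ by the gauge transformation y1 u y^(-1), which lies over x 0 x^(-1) = 0 in
    the BCH group and hence comes from the kernel. *)
Lemma moves_cls x eta eta' eta1 eta1' : moves x eta eta' -> moves x eta1 eta1' ->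
  MCcls kC eta = MCcls kC eta1 -> MCcls kC eta' = MCcls kC eta1'.
Proof.
move=> [y fy yE] [y1 fy1 y1E] /kclsP [u fu uE]; apply/kclsP.
exists (bch gP (bch gP y1 u) (- y)).
  by rewrite !(hom_bch gP hP) linearN /= fy fy1 fu bch0r // bchNr.
by rewrite -!gauge_bch // yE gaugeK // -uE.
Qed.

End FibreAction.

(** * The orbit space and the fibre *)

Section FibreQuotient.
Context (k : fieldType) (k0 : has_pchar0 k) (g h : curvedLie k).
Context (gP : pronilpotent g) (hP : pronilpotent h) (f : curvedHom g h).
Context (fsurj : forall i (y : h i), exists x, f i x = y).
Context (xi0 : MC h) (xi : g 1) (fxi : f 1 xi = mc_val xi0).
Local Notation hxi0 := (twist k0 (mc_val xi0)).
Local Notation hP0 := (twist_pronilpotent k0 (mc_val xi0) hP).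
Local Notation kxi := (fibre_lie k0 fxi).
Local Notation kC := (fibre_cone k0 fxi gP).

Definition fibre_act (c : H0 hxi0) (m : MCmod kC) : MCmod kC :=
  MCcls kC (sval (cid (moves_ex gP hP fsurj (fxi := fxi) (rep c) (rep m)))).

Lemma fibre_act_moves x (eta eta' : MC kxi) : moves gP x eta eta' ->
  fibre_act (H0cls x) (MCcls kC eta) = MCcls kC eta'.
Proof.
move=> xeta; rewrite /fibre_act; case: cid => eta1 /= h1.
apply: (moves_cls hP _ xeta (eta := rep (MCcls kC eta))); last exact: repK.
by apply: (moves_cohomologous hP fsurj) h1; apply: repK.
Qed.

Lemma MCmod_surj (m : MCmod kC) : exists eta, m = MCcls kC eta.
Proof. by exists (rep m); rewrite /MCcls repK. Qed.

Lemma fibre_act1 m : fibre_act (exp_one hxi0) m = m.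
Proof.
have [eta ->] := MCmod_surj m; apply: fibre_act_moves.
by exists 0; rewrite ?linear0 // gauge0.
Qed.

Lemma fibre_actM a b m :
  fibre_act (exp_mul hP0 a b) m = fibre_act a (fibre_act b m).
Proof.
have [x ->] := H0_surj a; have [y ->] := H0_surj b; have [eta ->] := MCmod_surj m.
have [eta1 h1] := moves_ex gP hP fsurj (fxi := fxi) y eta.
have [eta2 h2] := moves_ex gP hP fsurj (fxi := fxi) x eta1.
rewrite (fibre_act_moves h1) (fibre_act_moves h2) exp_mul_cls; apply: fibre_act_moves.
have [[v fv e1] [u fu e2]] := (h1, h2).
exists (bch gP u v); last by rewrite e2 e1 gauge_bch.
by rewrite (hom_bch gP hP) fu fv.
Qed.

Lemma MCcls_shift (eta eta' : MC kxi) : MCcls kC eta = MCcls kC eta' ->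
  MCcls gP (MC_shift eta) = MCcls gP (MC_shift eta').
Proof. by move=> /(kclsP gP hP) [u _ uE]; apply/(MCclsP k0); exists u. Qed.

Lemma MCcls_shift_orbit (m m' : MCmod kC) :
  act_orbit fibre_act m = act_orbit fibre_act m' ->
  MCcls gP (MC_shift (rep m)) = MCcls gP (MC_shift (rep m')).
Proof.
apply: (cls_ind (E := fun m m' => MCcls gP (MC_shift (rep m)) = MCcls gP (MC_shift (rep
  m')))) => //.
  by move=> x y z -> ->.
move=> {m m'} m m' [c cm]; have [x cx] := H0_surj c.
have [eta' h1] := moves_ex gP hP fsurj (fxi := fxi) x (rep m).
have m'E : MCcls kC eta' = MCcls kC (rep m').
  by rewrite -(fibre_act_moves h1) [RHS]repK -cm cx; congr fibre_act; apply: repK.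
rewrite -(MCcls_shift m'E); apply/MCclsP => //.
by have [y _ yE] := h1; exists y.
Qed.

Lemma MC_shift_fibre (eta : MC kxi) :
  MCmod_hom hP f (MCcls gP (MC_shift eta)) == MCcls hP xi0.
Proof.
apply/eqP; set c := MCcls gP _; apply/MCclsP => //.
have /(MCclsP k0) [y yE] : MCcls gP (rep c) = MCcls gP (MC_shift eta) by apply: repK.
exists (f 0 y); rewrite -[mc_val (MC_hom f _)]/(f 1 (mc_val (rep c))) -(hom_gauge gP hP) -yE.
exact/esym/f_sh.
Qed.

Definition fibre_map (o : act_orbits fibre_act) : MCfibre gP hP f xi0 :=
  exist _ (MCcls gP (MC_shift (rep (rep o)))) (MC_shift_fibre (rep (rep o))).

Lemma fibre_mapE eta :
  val (fibre_map (act_orbit fibre_act (MCcls kC eta))) = MCcls gP (MC_shift eta).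
Proof.
apply: etrans (MCcls_shift_orbit (_ : _ = act_orbit fibre_act (MCcls kC eta))) _.
  exact: repK.
by apply: MCcls_shift; apply: repK.
Qed.

Lemma fibre_map_inj : injective fibre_map.
Proof.
move=> o o' /(congr1 val).
have orbit_surj q : exists eta, q = act_orbit fibre_act (MCcls kC eta).
  by exists (rep (rep q)); rewrite /MCcls repK /act_orbit repK.
have [eta ->] := orbit_surj o; have [eta' ->] := orbit_surj o'.
rewrite !fibre_mapE => /(MCclsP k0) [y yE].
have dy : cl_d (add0r 1) (f 0 y : hxi0 0) == 0.
  apply/eqP/(cocycle_fix k0 hP).
  by rewrite -{1}(f_sh eta) -(hom_gauge gP hP) -[gauge _ _ _]yE f_sh.
apply: cls_step; exists (H0cls (exist _ (f 0 y : hxi0 0) dy)).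
by apply: fibre_act_moves; exists y.
Qed.

(** A representative of a class in the fibre lies only over a point gauge equivalent to xi0. Lifting
    that gauge transformation to [g] and applying it moves the representative exactly over xi0. *)
Lemma fibre_map_surj c : exists o, fibre_map o = c.
Proof.
case: c => c cf; have /(MCclsP k0) [y0 y0E] := eqP cf.
have [y fy] := fsurj y0.
have [||eta he] := @sh_surj _ k0 g h f xi0 xi fxi (gauge gP y (mc_val (rep c))).
- by apply: gauge_curv => //; apply: mc_valP.
- by rewrite (hom_gauge gP hP) fy y0E.
exists (act_orbit fibre_act (MCcls kC eta)); apply: val_inj; rewrite fibre_mapE /=.
rewrite -[RHS]repK; apply/esym/MCclsP => //.
by exists y.
Qed.

Lemma fibre_map_bij : bijective fibre_map.
Proof.
have [G hG] := choice fibre_map_surj.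
by exists G => // o; apply: fibre_map_inj; rewrite hG.
Qed.

End FibreQuotient.

Theorem theorem7p3p4 (k : fieldType) (k0 : has_pchar0 k)
    (g h : curvedLie k) (gP : pronilpotent g) (hP : pronilpotent h)
    (f : curvedHom g h) (fsurj : forall i (y : h i), exists x, f i x = y)
    (xi0 : MC h) (xi : g 1) (fxi : f 1 xi = mc_val xi0) :
  let hxi0 := twist k0 (mc_val xi0) in
  let hP0 := twist_pronilpotent k0 (mc_val xi0) hP in
  let kxi := fibre_lie k0 fxi in
  let kC := fibre_cone k0 fxi gP in
  [/\ associative (exp_mul hP0),
      left_id (exp_one hxi0) (exp_mul hP0)
    & left_inverse (exp_one hxi0) (@exp_inv k hxi0) (exp_mul hP0)]
  /\
  exists act : H0 hxi0 -> MCmod kC -> MCmod kC,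
    [/\ forall c, act (exp_one hxi0) c = c,
        forall a b c, act (exp_mul hP0 a b) c = act a (act b c),
        forall (x : Z0 hxi0) (y : g 0) (eta eta' : MC kxi),
          f 0 y = z0_val x ->
          mc_val (MC_shift eta') = gauge gP y (mc_val (MC_shift eta)) ->
          act (H0cls x) (MCcls kC eta) = MCcls kC eta'
      & exists Phi : act_orbits act -> MCfibre gP hP f xi0,
          bijective Phi /\
          forall eta : MC kxi,
            val (Phi (act_orbit act (MCcls kC eta))) = MCcls gP (MC_shift eta)].
Proof.
move=> hxi0 hP0 kxi kC; split.
  by split; [exact: exp_mulA|exact: exp_mul1l|exact: exp_mulVl].
exists (@fibre_act k k0 g h gP hP f fsurj xi0 xi fxi); split.
- exact: fibre_act1.
- exact: fibre_actM.
- by move=> x y eta eta' fy yE; apply: fibre_act_moves; exists y.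
exists (@fibre_map k k0 g h gP hP f fsurj xi0 xi fxi).
by split; [exact: fibre_map_bij|exact: fibre_mapE].
Qed.
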